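(* There is a Turing complete arithmetic term $\Upsilon(C,a,t)$ with the following property. Let $f:\mathbb{N}^s\to\mathbb{N}$ be a total function computed by a (normed) deterministic Turing machine with program code $C$, let $a\in\mathbb{N}^s$ be an input, and let $T(a)$ be an upper bound for the computation time of $C$ on input $a$. Then $$\Upsilon(C,a,T(a)) = f(a),$$ so that $f(a)$ is computed from $C$, $a$ and $T(a)$ by a finite and fixed number of arithmetic operations. In particular, a function $f:\mathbb{N}^s\to\mathbb{N}$ is Kalmar elementary if and only if its computation time is Kalmar elementary (that is, if and only if $f$ is computed by some deterministic Turing machine whose computation time is bounded by a Kalmar elementary function of the input).
   Context: $\mathbb{N}=\{0,1,2,\dots\}$. An arithmetic term is a finite expression built from variables ranging over $\mathbb{N}$ and natural-number constants by composing addition $x+y$, truncated subtraction $x \dot{-} y=\max(x-y,0)$, multiplication, $\lfloor x/y\rfloor$, $x \bmod y$, and exponentiation $x^y$ (conventions: $x \bmod 0 = x$; for definiteness $\lfloor x/0\rfloor=0$, $0^0=1$). The functions represented by arithmetic terms are exactly the Kalmar elementary functions (the class $\mathcal{E}^3$). Turing machines are deterministic, with one tape whose head never steps to the left of cell $0$, finite state set $Z$, finite tape alphabet $\Gamma$, start state and blank symbol both encoded by $0$. Normed machines: the machine starts in the start state with the head on the first digit of the input in cell $0$; it ends on the first digit of the output in cell $0$, with nothing but the output written on the tape; and every final state $z_e$ satisfies $\delta(z_e,\gamma)=(z_e,\gamma,0)$ for all $\gamma\in\Gamma$ (so configurations no longer change once the computation has ended). Program codes: states and letters are numbered from $0$;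 moves are $m\in\{0,1,2\}$ ($0$ no move, $1$ one cell right, $2$ one cell left). The transition function $\delta$ is a list of $d$ instructions $(z,a,z',a',m)$, meaning $\delta(z,a)=(z',a',m)$; it is encoded by the natural number $P$ whose digits in base $2^c$ are successively $2^z,2^a,2^{z'},2^{a'},2^m$ for each instruction, where $c$ is large enough that all of these digits are smaller than $2^c$. The program code is $C=[c\mid P]$, the Cantor pairing code of $(c,P)$. The arity $s$ is fixed; inputs $a\in\mathbb{N}^s$ are written on the tape, and outputs are read off the tape, by a fixed standard encoding (for example unary notation) computed by arithmetic terms from $a$ and $c$, respectively from the final tape content and $c$. *)

(* Defs.v *)
From mathcomp Require Import all_boot.

Set Implicit Arguments.
Unset Strict Implicit.
Unset Printing Implicit Defensive.

Inductive term (n : nat) : Type :=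
| Var of 'I_n
| Const of nat
| Add of term n & term n
| Sub of term n & term n
| Mul of term n & term n
| Div of term n & term n
| Mod of term n & term n
| Exp of term n & term n.

(** [subn] is truncated, and [x %/ 0 = 0], [x %% 0 = x], [0 ^ 0 = 1] hold in
    ssrnat/div. *)
Fixpoint eval (n : nat) (t : term n) (x : n.-tuple nat) : nat :=
  match t with
  | Var i => tnth x i
  | Const k => k
  | Add u v => eval u x + eval v x
  | Sub u v => eval u x - eval v x
  | Mul u v => eval u x * eval v x
  | Div u v => eval u x %/ eval v x
  | Mod u v => eval u x %% eval v x
  | Exp u v => eval u x ^ eval v x
  end.

(** [elem_ext] only makes the class insensitive to the intensional presentation
    of functions, so that functional extensionality is not needed. *)

Inductive elementary : forall n : nat, (n.-tuple nat -> nat) -> Prop :=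
| elem_zero n : elementary (fun _ : n.-tuple nat => 0)
| elem_succ : elementary (fun x : 1.-tuple nat => (thead x).+1)
| elem_proj n (i : 'I_n) : elementary (fun x : n.-tuple nat => tnth x i)
| elem_add : elementary (fun x : 2.-tuple nat => tnth x ord0 + tnth x ord_max)
| elem_sub : elementary (fun x : 2.-tuple nat => tnth x ord0 - tnth x ord_max)
| elem_comp m n (g : m.-tuple nat -> nat) (h : 'I_m -> n.-tuple nat -> nat) :
    elementary g -> (forall i, elementary (h i)) ->
    elementary (fun x : n.-tuple nat => g [tuple h i x | i < m])
| elem_sum n (f : n.+1.-tuple nat -> nat) :
    elementary f ->
    elementary (fun x : n.+1.-tuple nat =>
      \sum_(i < thead x) f [tuple of val i :: behead x])
| elem_prod n (f : n.+1.-tuple nat -> nat) :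
    elementary f ->
    elementary (fun x : n.+1.-tuple nat =>
      \prod_(i < thead x) f [tuple of val i :: behead x])
| elem_ext n (f g : n.-tuple nat -> nat) :
    f =1 g -> elementary f -> elementary g.

(** There are [nz.+1] states and [ng.+2] letters: the start state and the blank
    are [ord0], and letter 1 is the digit of unary notation. *)

Record machine : Type := Machine {
  nz : nat;
  ng : nat;
  final : {set 'I_nz.+1};
  delta : 'I_nz.+1 -> 'I_ng.+2 -> 'I_nz.+1 * 'I_ng.+2 * 'I_3
}.

Definition state (M : machine) := 'I_(nz M).+1.
Definition letter (M : machine) := 'I_(ng M).+2.

Definition blank (M : machine) : letter M := ord0.
Definition stroke (M : machine) : letter M :=
  @Ordinal (ng M).+2 1 isT.

Record config (M : machine) : Type := Config {
  cstate : state M;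
  ctape : nat -> letter M;
  chead : nat
}.

(** Moves: 0 stays, 1 goes right, 2 goes left.  Stepping to the left of cell 0
    is an error, which no successful computation may commit. *)
Definition move_head (m : 'I_3) (h : nat) : option nat :=
  match val m with
  | 0 => Some h
  | 1 => Some h.+1
  | _ => if h is h'.+1 then Some h' else None
  end.

Definition step (M : machine) (k : config M) : option (config M) :=
  let: (z, b, m) := delta (cstate k) (ctape k (chead k)) in
  omap
    (fun h => Config z (fun i => if i == chead k then b else ctape k i) h)
    (move_head m (chead k)).

(** The number [n] is written as [n.+1] strokes, so that there always is a first
    digit, and a tuple is written with one blank after each component. *)

Definition unary (M : machine) (n : nat) : seq (letter M) :=
  nseq n.+1 (stroke M).

Definition input_word (M : machine) (s : nat) (a : s.-tuple nat) :
    seq (letter M) :=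
  flatten [seq rcons (unary M x) (blank M) | x <- a].

Definition tape_of (M : machine) (w : seq (letter M)) : nat -> letter M :=
  fun i => nth (blank M) w i.

Definition init (M : machine) (s : nat) (a : s.-tuple nat) : config M :=
  Config (ord0 : state M) (tape_of (input_word M a)) 0.

Definition run (M : machine) (s : nat) (a : s.-tuple nat) (t : nat) :
    option (config M) :=
  iter t (obind (@step M)) (Some (init M a)).

Definition is_output (M : machine) (k : config M) (n : nat) : Prop :=
  chead k = 0 /\ ctape k =1 tape_of (unary M n).

(** The computation ends, in configuration [k], when it first reaches a final
    state. *)
Definition halts_at (M : machine) (s : nat) (a : s.-tuple nat)
    (t : nat) (k : config M) : Prop :=
  [/\ run M a t = Some k,
      cstate k \in final M
    & forall u k', u < t -> run M a u = Some k' -> cstate k' \notin final M].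

Definition comp_time (M : machine) (s : nat) (a : s.-tuple nat) (t : nat) :
    Prop :=
  exists k : config M, halts_at a t k.

Arguments comp_time M {s} a t.

Definition computes (M : machine) (s : nat) (f : s.-tuple nat -> nat) : Prop :=
  forall a : s.-tuple nat,
    exists t (k : config M), halts_at a t k /\ is_output k (f a).

(** The conditions of a normed machine on the initial and the halting
    configuration are part of [computes]; this is the remaining one. *)
Definition normed (M : machine) : Prop :=
  forall z g, z \in final M -> delta (m := M) z g = (z, g, ord0).

Definition time_bounded (M : machine) (s : nat) (T : s.-tuple nat -> nat) :
    Prop :=
  forall a : s.-tuple nat, exists2 t, comp_time M a t & t <= T a.

Definition cantor (x y : nat) : nat := ((x + y) * (x + y).+1) %/ 2 + y.

(** Least significant digit first. *)
Definition of_digits (b : nat) (ds : seq nat) : nat :=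
  \sum_(i < size ds) nth 0 ds i * b ^ i.

Definition instruction_digits (M : machine) (zg : state M * letter M) :
    seq nat :=
  let: (z', g', m) := delta zg.1 zg.2 in
  [:: 2 ^ zg.1; 2 ^ zg.2; 2 ^ z'; 2 ^ g'; 2 ^ m].

(** The instructions may be listed in any order [l], each of them once; hence a
    machine has many program codes. *)
Definition program_code (M : machine) (C : nat) : Prop :=
  exists (c : nat) (l : seq (state M * letter M)),
    let ds := flatten [seq instruction_digits zg | zg <- l] in
    [/\ perm_eq l (enum {: state M * letter M}),
        all (fun d => d < 2 ^ c) ds
      & C = cantor c (of_digits (2 ^ c) ds)].

(* Main.v *)
(** Simulating a machine for [T] steps is a bounded recursion on a numerical code
    of the configuration, in which the instruction to apply is found by a bounded
    sum over the program.  Bounded recursion reduces to bounded sums, by summing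
    over all the codes of finite sequences, so that everything rests on a theorem of
    Mazzanti: arithmetic terms are closed under bounded sums.  Flattening a term
    into equations between exponential polynomials, in which each variable is
    determined by the previous ones, turns such a sum into the number of points [u]
    of a cube at which a sum of squares [X u] vanishes.  The number with base
    [2 ^ (2 q)] digits [(2 ^ q - 1) * X u] is a combination of sums of the form
    [\sum_(v < N) v ^ a * b ^ v], hence an arithmetic term, and its binary weight is
    [q] times the number of points with [X u != 0].  The binary weight of [n] is the
    2-adic valuation of ['C(2 n, n)] (Legendre), which is an arithmetic term.

    Conversely, an elementary function is given by an arithmetic term, which a
    program with counters evaluates on a stack, in a time bounded by such a term.
    The counters are kept in unary on the tracks of the tape of a machine. *)

Require Import Defs.
From mathcomp Require Import all_boot.
From mathcomp Require Import zify.

Set Implicit Arguments.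
Unset Strict Implicit.
Unset Printing Implicit Defensive.

(** * Arithmetic terms *)

(** The obstacle is that only sums of [v ^ a * b ^ v] with a fixed exponent [a] have a closed form,
    while a test such as [X u == 0] is not of this shape. So the sum over the cube is taken first,
    on the values of [X] themselves, and the test is made afterwards on the digits of the result,
    for all points at once. Division is restricted to divisors [v.+1] and exponentiation to base 2.
    Exponential polynomials then involve only the powers [2 ^ y] of their variables, and the graph
    of each operation is a system of equations with a unique solution. Uniqueness is essential: an
    auxiliary variable with two admissible values would make its point count twice. The valuation at
    2 comes from a gcd, as [gcdn m (2 ^ m)] is the power of 2 in [m], and a gcd is a digit of a
    product of geometric sums. A program code does not tell which states are final, and only a bound
    [T] of the time is given. The simulation therefore makes exactly [T] steps, and relies on a
    normed machine keeping its output after it has halted. In the equivalence, where machines are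
    not assumed normed, they are first made so. *)

Inductive aterm : Type :=
| AVar of nat
| ACst of nat
| AAdd of aterm & aterm
| ASub of aterm & aterm
| AMul of aterm & aterm
| ADivS of aterm & aterm
| APow2 of aterm.

Fixpoint aeval (t : aterm) (e : nat -> nat) : nat :=
  match t with
  | AVar k => e k
  | ACst c => c
  | AAdd u v => aeval u e + aeval v e
  | ASub u v => aeval u e - aeval v e
  | AMul u v => aeval u e * aeval v e
  | ADivS u v => aeval u e %/ (aeval v e).+1
  | APow2 u => 2 ^ aeval u e
  end.

Lemma eq_aeval t e e' : e =1 e' -> aeval t e = aeval t e'.
Proof.
move=> ee; elim: t => //= [u IHu v IHv|u IHu v IHv|u IHu v IHv|u IHu v IHv|u IHu];
  by rewrite IHu ?IHv.
Qed.

Fixpoint asubst (s : nat -> aterm) (t : aterm) : aterm :=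
  match t with
  | AVar k => s k
  | ACst c => ACst c
  | AAdd u v => AAdd (asubst s u) (asubst s v)
  | ASub u v => ASub (asubst s u) (asubst s v)
  | AMul u v => AMul (asubst s u) (asubst s v)
  | ADivS u v => ADivS (asubst s u) (asubst s v)
  | APow2 u => APow2 (asubst s u)
  end.

Lemma aeval_subst s t e :
  aeval (asubst s t) e = aeval t (fun k => aeval (s k) e).
Proof.
by elim: t => //= [u -> v ->|u -> v ->|u -> v ->|u -> v ->|u ->].
Qed.

Definition scons {A : Type} (x : A) (e : nat -> A) (k : nat) : A :=
  if k is k'.+1 then e k' else x.

(** Environments are infinite, so that binding a variable is a shift of the indices and no arity has
    to be tracked. *)
Definition arith (f : (nat -> nat) -> nat) : Prop :=
  exists t, forall e, aeval t e = f e.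

Lemma eq_arith f g : f =1 g -> arith f -> arith g.
Proof. by move=> fg [t Ht]; exists t => e; rewrite Ht fg. Qed.

Lemma arith_aeval t : arith (aeval t).
Proof. by exists t. Qed.

Lemma arith_var k : arith (fun e => e k).
Proof. by exists (AVar k). Qed.

Lemma arith_const c : arith (fun=> c).
Proof. by exists (ACst c). Qed.

Section Closure.

Variables f g : (nat -> nat) -> nat.
Hypotheses (Hf : arith f) (Hg : arith g).

Lemma arith_add : arith (fun e => f e + g e).
Proof. by case: Hf Hg => [t Ht] [u Hu]; exists (AAdd t u) => e /=; rewrite Ht Hu. Qed.

Lemma arith_sub : arith (fun e => f e - g e).
Proof. by case: Hf Hg => [t Ht] [u Hu]; exists (ASub t u) => e /=; rewrite Ht Hu. Qed.

Lemma arith_mul : arith (fun e => f e * g e).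
Proof. by case: Hf Hg => [t Ht] [u Hu]; exists (AMul t u) => e /=; rewrite Ht Hu. Qed.

Lemma arith_divS : arith (fun e => f e %/ (g e).+1).
Proof. by case: Hf Hg => [t Ht] [u Hu]; exists (ADivS t u) => e /=; rewrite Ht Hu. Qed.

Lemma arith_pow2 : arith (fun e => 2 ^ f e).
Proof. by case: Hf => [t Ht]; exists (APow2 t) => e /=; rewrite Ht. Qed.

Lemma arith_succ : arith (fun e => (f e).+1).
Proof. by case: Hf => [t Ht]; exists (AAdd (ACst 1) t) => e /=; rewrite Ht. Qed.

End Closure.

Lemma arith_pred f : arith f -> arith (fun e => (f e).-1).
Proof.
move=> Hf; apply: (@eq_arith (fun e => f e - 1)); first by move=> e; rewrite subn1.
exact: arith_sub Hf (arith_const 1).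
Qed.

Lemma arith_leq f g : arith f -> arith g -> arith (fun e => (f e <= g e : nat)).
Proof.
move=> Hf Hg; apply: (@eq_arith (fun e => 1 - (f e - g e))); first by move=> e; lia.
exact: arith_sub (arith_const 1) (arith_sub Hf Hg).
Qed.

Lemma arith_andb (a b : (nat -> nat) -> bool) :
  arith (fun e => a e : nat) -> arith (fun e => b e : nat) ->
  arith (fun e => (a e && b e : nat)).
Proof.
move=> Ha Hb; apply: (@eq_arith (fun e => (a e : nat) * (b e))).
  by move=> e; rewrite mulnb.
exact: arith_mul.
Qed.

Lemma arith_eqn f g : arith f -> arith g -> arith (fun e => (f e == g e : nat)).
Proof.
move=> Hf Hg; apply: (@eq_arith (fun e => (f e <= g e) && (g e <= f e) : nat)).
  by move=> e; rewrite eqn_leq.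
by apply: arith_andb; apply: arith_leq.
Qed.

Lemma arith_div f g : arith f -> arith g -> arith (fun e => f e %/ g e).
Proof.
move=> Hf Hg.
apply: (@eq_arith (fun e => (f e %/ (g e).-1.+1) * (1 <= g e : nat))).
  by move=> e; case: (g e) => [|k] /=; rewrite ?divn0 ?muln0 ?muln1.
apply: arith_mul; first exact: arith_divS Hf (arith_pred Hg).
exact: arith_leq (arith_const 1) Hg.
Qed.

Lemma arith_mod f g : arith f -> arith g -> arith (fun e => f e %% g e).
Proof.
move=> Hf Hg; apply: (@eq_arith (fun e => f e - f e %/ g e * g e)).
  by move=> e; rewrite {1}(divn_eq (f e) (g e)) addKn.
exact: arith_sub Hf (arith_mul (arith_div Hf Hg) Hg).
Qed.

(* [2 ^ k] is congruent to [x] modulo [2 ^ k - x]. *)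
Lemma expn_modn_pow2 x y k :
  x + x ^ y < 2 ^ k -> (2 ^ (k * y)) %% (2 ^ k - x) = x ^ y.
Proof.
move=> Hk; have x_lt : x < 2 ^ k by lia.
rewrite expnM -modnXm -{1}(subnK (ltnW x_lt)) modnDl modnXm modn_small //; lia.
Qed.

Lemma arith_exp f g : arith f -> arith g -> arith (fun e => f e ^ g e).
Proof.
(* With [x = f e] and [y = g e], the bounds [x < 2 ^ x] and [x ^ y <= 2 ^ (x.+1 * y.+1)] give
   [x + x ^ y < 2 ^ k]. *)
move=> Hf Hg; pose k e := (f e).+1 * (g e).+1 + f e + 1.
have Hk : arith k.
  apply: arith_add (arith_add _ Hf) (arith_const 1).
  exact: arith_mul (arith_succ Hf) (arith_succ Hg).
apply: (@eq_arith (fun e => (2 ^ (k e * g e)) %% (2 ^ k e - f e))); last first.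
  apply: arith_mod; first exact: arith_pow2 (arith_mul Hk Hg).
  exact: arith_sub (arith_pow2 Hk) Hf.
move=> e; apply: expn_modn_pow2; rewrite /k.
set x := f e; set y := g e.
have H1 : x < 2 ^ x := ltn_expl x (ltnSn 1).
have H2 : x ^ y <= 2 ^ (x.+1 * y.+1).
  apply: (@leq_trans (2 ^ (x * y))); last by rewrite leq_exp2l //; nia.
  by rewrite expnM; case: (y) => // y'; rewrite leq_exp2r // ltnW.
rewrite !expnD expn1; have : 0 < 2 ^ (x.+1 * y.+1) by rewrite expn_gt0.
nia.
Qed.

Lemma arith_if (b : (nat -> nat) -> bool) f g :
  arith (fun e => b e : nat) -> arith f -> arith g ->
  arith (fun e => if b e then f e else g e).
Proof.
move=> Hb Hf Hg.
apply: (@eq_arith (fun e => b e * f e + (1 - b e) * g e)).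
  by move=> e; case: (b e); rewrite ?mul1n ?mul0n ?addn0.
apply: arith_add; apply: arith_mul => //.
by apply: arith_sub => //; apply: arith_const.
Qed.

(* The other variables are shifted by the [c] binders that have been crossed. *)
Lemma arith_open2 c (F : nat -> nat -> (nat -> nat) -> nat) f1 f2 :
  arith (fun e => F (e 0) (e 1) (fun k => e k.+2)) -> arith f1 -> arith f2 ->
  arith (fun e => F (f1 e) (f2 e) (fun k => e (c + k))).
Proof.
move=> [u Hu] [t1 H1] [t2 H2].
exists (asubst (scons t1 (scons t2 (fun k => AVar (c + k)))) u) => e.
by rewrite aeval_subst Hu /= H1 H2.
Qed.

Lemma arith_shift c f : arith f -> arith (fun e => f (fun k => e (c + k))).
Proof.
move=> [u Hu]; exists (asubst (fun k => AVar (c + k)) u) => e.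
by rewrite aeval_subst Hu.
Qed.

Lemma arith_neg (b : (nat -> nat) -> bool) :
  arith (fun e => b e : nat) -> arith (fun e => ~~ b e : nat).
Proof.
move=> Hb; apply: (@eq_arith (fun e => 1 - b e)); first by move=> e; case: (b e).
exact: arith_sub (arith_const 1) Hb.
Qed.

(* Applying the closure lemmas by unification alone would unfold [expn]. *)
Ltac arith_step :=
  lazymatch goal with
  | |- arith (fun e => e ?k) => exact (arith_var k)
  | |- arith (fun _ => ?c) => exact (arith_const c)
  | |- arith (fun e => S (@?f e)) => apply (@arith_succ f)
  | |- arith (fun e => predn (@?f e)) => apply (@arith_pred f)
  | |- arith (fun e => addn (@?f e) (@?g e)) => apply (@arith_add f g)
  | |- arith (fun e => subn (@?f e) (@?g e)) => apply (@arith_sub f g)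
  | |- arith (fun e => muln (@?f e) (@?g e)) => apply (@arith_mul f g)
  | |- arith (fun e => divn (@?f e) (@?g e)) => apply (@arith_div f g)
  | |- arith (fun e => modn (@?f e) (@?g e)) => apply (@arith_mod f g)
  | |- arith (fun e => expn (@?f e) (@?g e)) => apply (@arith_exp f g)
  | |- arith (fun e => if _ then _ else _) => apply: arith_if
  | |- arith (fun e => nat_of_bool (@?a e && @?b e)) => apply (@arith_andb a b)
  | |- arith (fun e => nat_of_bool (~~ @?a e)) => apply (@arith_neg a)
  | |- arith (fun e => nat_of_bool (leq (@?f e) (@?g e))) => apply (@arith_leq f g)
  | |- arith (fun e => nat_of_bool (eq_op (@?f e) (@?g e))) => apply (@arith_eqn f g)
  end; cbv beta.

Ltac arith_tac := repeat first [ eassumption | arith_step ].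

(* Summation by parts. *)
Lemma power_sum_rec a n c :
  0 < c ->
  (c - 1) * (\sum_(v < n) v ^ a * c ^ v)
    + c * (\sum_(j < a) 'C(a, j) * (\sum_(v < n) v ^ j * c ^ v)) + (a == 0)
  = n ^ a * c ^ n.
Proof.
move=> c_gt0; elim: n => [|n IHn].
  rewrite big_ord0 big1 => [|j _]; last by rewrite big_ord0 muln0.
  by rewrite !muln0; case: a => [|a] //; rewrite exp0n.
have binom : n.+1 ^ a = \sum_(j < a) 'C(a, j) * n ^ j + n ^ a.
  rewrite -[n.+1]add1n expnDn big_ord_recr /= binn mul1n subnn mul1n.
  by congr (_ + _); apply: eq_bigr => j _; rewrite exp1n mul1n.
rewrite big_ord_recr /=.
under [\sum_(j < a) _]eq_bigr => j _ do rewrite big_ord_recr /= mulnDr mulnA.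
rewrite big_split /= -big_distrl /= binom expnS.
set X := \sum_(j < a) 'C(a, j) * n ^ j.
set S := \sum_(v < n) v ^ a * c ^ v in IHn *.
set Z := \sum_(j < a) _ * _ in IHn *.
have {binom}: (c - 1) * (n ^ a * c ^ n) + n ^ a * c ^ n = c * (n ^ a * c ^ n).
  by rewrite mulnBl mul1n subnK // leq_pmull.
nia.
Qed.

Lemma arith_sum_ord m (F : nat -> (nat -> nat) -> nat) :
  (forall j, j < m -> arith (F j)) -> arith (fun e => \sum_(j < m) F j e).
Proof.
elim: m => [|m IHm] HF.
  by apply: (@eq_arith (fun=> 0)) => [e|]; [rewrite big_ord0 | apply: arith_const].
apply: (@eq_arith (fun e => \sum_(j < m) F j e + F m e)).
  by move=> e; rewrite big_ord_recr.
by apply: arith_add; [apply: IHm => j /ltnW; apply: HF | apply: HF].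
Qed.

(** As [a] is a fixed number, [power_sum_rec] unfolds into a term by strong induction on [a]; the
    hypothesis [1 < b e] allows the division by [b e - 1]. *)
Lemma arith_power_sum a N b :
  arith N -> arith b -> (forall e, 1 < b e) ->
  arith (fun e => \sum_(v < N e) v ^ a * b e ^ v).
Proof.
move=> HN Hb b_gt1; elim/ltn_ind: a => a IHa.
pose Z e := \sum_(j < a) 'C(a, j) * (\sum_(v < N e) v ^ j * b e ^ v).
have HZ : arith Z.
  apply: (@arith_sum_ord a (fun j e => 'C(a, j) * \sum_(v < N e) v ^ j * b e ^ v)).
  by move=> j lt_ja; apply: arith_mul (IHa j lt_ja); apply: arith_const.
apply: (@eq_arith (fun e => (N e ^ a * b e ^ N e - (a == 0) - b e * Z e) %/ (b e - 2).+1)).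
  move=> e; have b_gt0 := ltnW (b_gt1 e).
  rewrite -(power_sum_rec a (N e) b_gt0) addnK addnK.
  have -> : (b e - 2).+1 = b e - 1 by have := b_gt1 e; lia.
  by rewrite mulKn // subn_gt0 b_gt1.
by arith_tac.
Qed.

(** * The binary weight as an arithmetic term *)

Lemma digits_recl n (d : nat -> nat) b :
  \sum_(i < n.+1) d i * b ^ i = (\sum_(i < n) d i.+1 * b ^ i) * b + d 0.
Proof.
rewrite big_ord_recl muln1 addnC big_distrl /=; congr (_ + _).
by apply: eq_bigr => i _; rewrite /bump add1n expnSr mulnA.
Qed.

Lemma ltn_digits n (d : nat -> nat) b :
  (forall i, i < n -> d i < b) -> \sum_(i < n) d i * b ^ i < b ^ n.
Proof.
elim: n d => [|n IHn] d d_lt; first by rewrite big_ord0.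
rewrite digits_recl expnSr; have := IHn _ (fun i lt => d_lt i.+1 lt).
by have := d_lt 0 isT; nia.
Qed.

Lemma digitE n (d : nat -> nat) b k :
  (forall i, i < n -> d i < b) -> k < n ->
  (\sum_(i < n) d i * b ^ i) %/ b ^ k %% b = d k.
Proof.
elim: n d k => [//|n IHn] d k d_lt; rewrite digits_recl.
have d0_lt := d_lt 0 isT; have b_gt0 : 0 < b by lia.
case: k => [_|k lt_kn]; first by rewrite divn1 modnMDl modn_small.
rewrite expnS divnMA divnMDl // (divn_small d0_lt) addn0.
exact: (IHn (fun i => d i.+1)) (fun i lt => d_lt i.+1 lt) _.
Qed.

Lemma sum_eq_mul_dvd b m n :
  0 < b -> m <= n * b -> 0 < m -> b %| n * b - m ->
  \sum_(y < n) (m + b * y == n * b) = 1.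
Proof.
move=> b_gt0 le_m m_gt0 /dvdnP[y def_y].
have lt_yn : y < n by nia.
rewrite (bigD1 (Ordinal lt_yn)) //= big1 ?addn0 => [|z].
  by have -> : m + b * y == n * b by apply/eqP; nia.
rewrite -val_eqE /= => z_neq; apply/eqP; rewrite eqb0; apply/eqP => E.
by case/eqP: z_neq; nia.
Qed.

(* Hence [gcdn a b] is a coefficient of the product of two geometric sums. *)
Lemma count_gcd a b :
  0 < a -> 0 < b ->
  \sum_(x < b) \sum_(y < a) (a * x.+1 + b * y == a * b) = gcdn a b.
Proof.
move=> a_gt0 b_gt0.
have [g_gt0 a_eq b_eq] : [/\ 0 < gcdn a b, a = a %/ gcdn a b * gcdn a b
    & b = b %/ gcdn a b * gcdn a b].
  by rewrite gcdn_gt0 a_gt0 !divnK ?dvdn_gcdl ?dvdn_gcdr.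
have cop : coprime (b %/ gcdn a b) (a %/ gcdn a b).
  rewrite /coprime -(eqn_pmul2r g_gt0) mul1n muln_gcdl -a_eq -b_eq.
  by rewrite gcdnC.
move: (gcdn a b) g_gt0 (a %/ _) (b %/ _) a_eq b_eq cop => g g_gt0 a' b' a_eq b_eq cop.
(* For a given [x] there is a [y], and only one, exactly when [b] divides [a * x.+1], that is when
   [b' = b / gcd] divides [x.+1]; there are [b / b'] such [x]. *)
transitivity (\sum_(x < b) (b' %| x.+1)).
  apply: eq_bigr => x _.
  have dvdE : (b %| a * b - a * x.+1) = (b' %| x.+1).
    rewrite (dvdn_subr _ (dvdn_mull a (dvdnn b))) ?leq_mul //.
    by move: (nat_of_ord x).+1 => z; rewrite a_eq b_eq mulnAC dvdn_pmul2r // Gauss_dvdr.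
  case: (boolP (b' %| _)) => b'x.
    by apply: sum_eq_mul_dvd; rewrite ?muln_gt0 ?a_gt0 ?leq_mul // dvdE.
  apply: big1 => y _; apply/eqP; rewrite eqb0; apply: contra b'x => /eqP E.
  by rewrite -dvdE -E addKn dvdn_mulr.
have -> : \sum_(x < b) (b' %| x.+1) = \sum_(1 <= x < b.+1) (b' %| x).
  by rewrite big_add1 big_mkord.
have b'_gt0 : 0 < b' by case: (b') b_eq b_gt0 => // ->.
by rewrite -divn_count_dvd b_eq mulKn.
Qed.

Lemma sum_pow_digits (I : finType) (phi : I -> nat) B M :
  (forall i, phi i < M) ->
  \sum_i B ^ phi i = \sum_(k < M) (\sum_i (phi i == k)) * B ^ k.
Proof.
move=> phi_lt; under [RHS]eq_bigr => k _ do rewrite big_distrl /=.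
rewrite exchange_big; apply: eq_bigr => i _ /=.
rewrite (bigD1 (Ordinal (phi_lt i))) //= eqxx mul1n big1 ?addn0 // => k.
by rewrite -val_eqE /= eq_sym => /negbTE ->.
Qed.

(** The product expands into the powers [B ^ (a * x.+1 + b * y)] over [a * b] pairs. Each
    coefficient is thus at most [a * b < B], no carry occurs, and the digit of rank [a * b] is the
    number of solutions in [count_gcd]. *)
Lemma gcdn_digit a b (B := (a * b).+2) :
  0 < a -> 0 < b ->
  (B ^ a * (\sum_(x < b) (B ^ a) ^ x) * (\sum_(y < a) (B ^ b) ^ y))
    %/ B ^ (a * b) %% B = gcdn a b.
Proof.
move=> a_gt0 b_gt0.
pose phi (p : 'I_b * 'I_a) := a * p.1.+1 + b * p.2.
have phi_lt p : phi p < (a * b) + (a * b) + 1.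
  by rewrite /phi; case: p => x y /=; have := ltn_ord x; have := ltn_ord y; nia.
have -> : B ^ a * (\sum_(x < b) (B ^ a) ^ x) * (\sum_(y < a) (B ^ b) ^ y)
    = \sum_p B ^ phi p.
  rewrite -(pair_big xpredT xpredT (fun x y => B ^ phi (x, y))) /=.
  rewrite [B ^ a * _]big_distrr big_distrl /=; apply: eq_bigr => x _ /=.
  rewrite big_distrr /=; apply: eq_bigr => y _.
  by rewrite /phi /= expnD mulnS !expnD !expnM.
rewrite (sum_pow_digits _ phi_lt).
rewrite (@digitE _ (fun k => \sum_i (phi i == k))) => [|k _|]; last by lia.
  rewrite -(count_gcd a_gt0 b_gt0).
  by rewrite -(pair_big xpredT xpredT (fun x y => (phi (x, y) == a * b : nat))).
apply: (@leq_ltn_trans (\sum_(i : 'I_b * 'I_a) 1)).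
  by apply: leq_sum => i _; case: eqP.
by rewrite sum1_card card_prod !card_ord /B; lia.
Qed.

Lemma arith_gcd f g :
  arith f -> arith g -> (forall e, 0 < f e) -> (forall e, 0 < g e) ->
  arith (fun e => gcdn (f e) (g e)).
Proof.
move=> Hf Hg f_gt0 g_gt0.
pose B e := (f e * g e).+2.
have HB : arith B by rewrite /B; arith_tac.
have geom N u : arith N -> arith u -> (forall e, 0 < u e) ->
    arith (fun e => \sum_(x < N e) (B e ^ u e) ^ x).
  move=> HN Hu u_gt0.
  apply: (@eq_arith (fun e => \sum_(x < N e) x ^ 0 * (B e ^ u e) ^ x)).
    by move=> e; apply: eq_bigr => x _; rewrite mul1n.
  apply: arith_power_sum => // [|e]; first by arith_tac.
  by rewrite -(exp1n (u e)) ltn_exp2r.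
apply: eq_arith => [e|]; first exact: gcdn_digit (f_gt0 e) (g_gt0 e).
by arith_tac; apply: geom.
Qed.

(** The odd part of [m] is coprime to [2 ^ m], and [logn 2 m <= m] lets the whole power of 2
    survive. *)
Lemma gcdn_pow2 m : 0 < m -> gcdn m (2 ^ m) = 2 ^ logn 2 m.
Proof.
move=> m_gt0.
have [[|k] /andP[odd_k def_m]] : exists k, coprime 2 k && (m == k * 2 ^ logn 2 m).
  by have [k c E] := @pfactor_coprime 2 m isT m_gt0; exists k; rewrite c -E eqxx.
  by move: odd_k; rewrite /coprime gcdn0.
set l := logn 2 m in def_m *; rewrite {1}(eqP def_m).
have lm : l <= m by apply: ltnW; apply: leq_trans (ltn_expl l (ltnSn 1)) _; nia.
rewrite -(subnKC lm) expnD [k.+1 * _]mulnC -muln_gcdr.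
suff -> : gcdn k.+1 (2 ^ (m - l)) = 1 by rewrite muln1.
by apply/eqP; rewrite -/(coprime _ _) coprime_sym coprimeXl.
Qed.

(** The binomial expansion of [(1 + mu) ^ v], cut after its linear term; this is a discrete
    logarithm in base [1 + mu]. *)
Lemma expn_modn_sqr mu v :
  1 < mu -> v < mu -> mu.+1 ^ v %% mu ^ 2 = 1 + v * mu.
Proof.
move=> mu_gt1 v_lt.
have -> : mu.+1 ^ v = 1 + v * mu %[mod mu ^ 2].
  elim: v {v_lt} => [|v IHv]; first by [].
  rewrite expnS -modnMmr IHv modnMmr.
  have -> : mu.+1 * (1 + v * mu) = v * mu ^ 2 + (1 + v.+1 * mu) by nia.
  by rewrite modnMDl.
rewrite modn_small //; nia.
Qed.

(* The base [2 ^ (m + 2)] turns [2 ^ l] into [(1 + mu) ^ l = 1 + l mu]. *)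
Lemma arith_logn2 f :
  arith f -> (forall e, 0 < f e) -> arith (fun e => logn 2 (f e)).
Proof.
move=> Hf f_gt0; pose mu e := 2 ^ (f e).+2 - 1.
have Hmu : arith mu by rewrite /mu; arith_tac.
have Hg : arith (fun e => gcdn (f e) (2 ^ f e)).
  by apply: arith_gcd => [||//|e]; [|arith_tac|rewrite expn_gt0].
apply: (@eq_arith (fun e =>
  ((gcdn (f e) (2 ^ f e)) ^ (f e).+2 %% mu e ^ 2) %/ mu e)); last by arith_tac.
move=> e; rewrite gcdn_pow2 // -expnM mulnC expnM.
have lt_f := ltn_expl (f e) (ltnSn 1).
have lt_l : logn 2 (f e) < f e.
  apply: leq_trans (ltn_expl _ (ltnSn 1)) _; apply: dvdn_leq => //; exact: pfactor_dvdnn.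
have -> : 2 ^ (f e).+2 = (mu e).+1 by rewrite /mu !expnS; lia.
have mu_gt : f e + 1 < mu e by rewrite /mu !expnS; lia.
rewrite expn_modn_sqr; try lia.
by rewrite addnC divnMDl ?divn_small ?addn0; lia.
Qed.

(* The binary weight of [n], by Legendre's formula. *)
Definition hw (n : nat) : nat := n - logn 2 n`!.

Lemma logn2_fact_double n : logn 2 (n.*2)`! = n + logn 2 n`!.
Proof.
elim: n => [|n IHn]; first by [].
rewrite doubleS !factS !lognM ?muln_gt0 ?fact_gt0 // IHn.
have -> : logn 2 n.*2.+1 = 0.
  by apply: logn_coprime; rewrite coprime2n /= odd_double.
by rewrite -doubleS -mul2n lognM // (_ : logn 2 2 = 1) //; lia.
Qed.

Lemma logn2_fact_doubleS n : logn 2 (n.*2.+1)`! = n + logn 2 n`!.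
Proof.
rewrite factS lognM ?fact_gt0 // logn2_fact_double.
by rewrite logn_coprime // coprime2n /= odd_double.
Qed.

Lemma logn2_fact_leq n : logn 2 n`! <= n.
Proof.
elim/ltn_ind: n => n IHn; case: (posnP n) => [->//|n_gt0].
have := IHn n./2 ltac:(lia); rewrite -{3 4}(odd_double_half n).
by case: (odd n); rewrite ?add1n ?add0n ?logn2_fact_doubleS ?logn2_fact_double; lia.
Qed.

Lemma hw0 : hw 0 = 0. Proof. by []. Qed.

(** With [hw0], this recursion identifies [hw] as the sum of the binary digits. *)
Lemma hw_bit (b : bool) n : hw (b + n.*2) = b + hw n.
Proof.
have := logn2_fact_leq n; rewrite /hw.
by case: b; rewrite ?add1n ?add0n ?logn2_fact_doubleS ?logn2_fact_double; lia.
Qed.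

Lemma hw_cat q x y : x < 2 ^ q -> hw (x + 2 ^ q * y) = hw x + hw y.
Proof.
elim: q x => [|q IHq] x; first by rewrite expn0 ltnS leqn0 mul1n => /eqP->.
rewrite expnS => x_lt; rewrite -(odd_double_half x) -addnA.
have -> : (x./2).*2 + 2 * 2 ^ q * y = (x./2 + 2 ^ q * y).*2 by lia.
by rewrite !hw_bit IHq ?addnA //; lia.
Qed.

Lemma hw_compl q u : u < 2 ^ q -> hw u + hw (2 ^ q - 1 - u) = q.
Proof.
elim: q u => [|q IHq] u; first by rewrite expn0 ltnS leqn0 => /eqP->.
rewrite expnS => u_lt; have := IHq u./2 ltac:(lia).
have := odd_double_half u; case: (odd u) => /= u_eq.
  have -> : 2 * 2 ^ q - 1 - u = false + (2 ^ q - 1 - u./2).*2 by lia.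
  have -> : hw u = true + hw u./2 by rewrite -hw_bit -{1}u_eq.
  by rewrite hw_bit; lia.
have -> : 2 * 2 ^ q - 1 - u = true + (2 ^ q - 1 - u./2).*2 by lia.
have -> : hw u = false + hw u./2 by rewrite -hw_bit -{1}u_eq.
by rewrite hw_bit; lia.
Qed.

(** For [v = u.+1] the upper block of [q] bits is [u] and the lower one is its complement
    [2 ^ q - 1 - u]. Together they contain [q] ones whatever [u] is, so the weight only tells
    whether [v] vanishes. *)
Lemma hw_mulM q v : v < 2 ^ q -> hw ((2 ^ q - 1) * v) = q * (v != 0).
Proof.
case: v => [|u] u_lt; first by rewrite eqxx !muln0 hw0.
have -> : (2 ^ q - 1) * u.+1 = (2 ^ q - 1 - u) + 2 ^ q * u.
  by rewrite mulnBl mul1n mulnS; lia.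
rewrite muln1 hw_cat; last by lia.
by rewrite addnC hw_compl // ltnW.
Qed.

(** The factorial of Legendre's formula gives way to a binomial coefficient, which can be read off
    as a digit of a power. *)
Lemma hw_binomial n : hw n = logn 2 'C(n.*2, n).
Proof.
have := logn2_fact_double n; have := logn2_fact_leq n.
rewrite -(@bin_fact n.*2 n) -?addnn ?leq_addr // addnK.
rewrite !lognM ?muln_gt0 ?fact_gt0 ?bin_gt0 ?leq_addr // /hw.
by move=> le_n E; lia.
Qed.

(** The coefficients of [(1 + B) ^ n] are at most [2 ^ n], hence they are its digits in base
    [B = 2 ^ n.+1]. *)
Lemma binomial_digit n k :
  k <= n -> ((2 ^ n.+1).+1 ^ n) %/ (2 ^ n.+1) ^ k %% (2 ^ n.+1) = 'C(n, k).
Proof.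
move=> le_kn; have -> : (2 ^ n.+1).+1 ^ n = \sum_(i < n.+1) 'C(n, i) * (2 ^ n.+1) ^ i.
  rewrite -add1n expnDn; apply: eq_bigr => i _; by rewrite exp1n mul1n.
apply: digitE => // i lt_in; rewrite expnS.
suff : 'C(n, i) <= 2 ^ n by have := expn_gt0 2 n; lia.
rewrite -[2]/(1 + 1) expnDn (bigD1 (Ordinal lt_in)) //= !exp1n !muln1.
exact: leq_addr.
Qed.

Lemma arith_hw f : arith f -> arith (fun e => hw (f e)).
Proof.
move=> Hf; apply: (@eq_arith (fun e => logn 2 'C((f e).*2, f e))).
  by move=> e; rewrite hw_binomial.
apply: (arith_logn2 (f := fun e => 'C((f e).*2, f e))) => [|e]; last first.
  by rewrite bin_gt0 -addnn leq_addr.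
have H2 : arith (fun e => (f e).*2).
  by apply: (@eq_arith (fun e => f e + f e)) => [e|]; [rewrite addnn | arith_tac].
apply: eq_arith => [e|].
  by apply: binomial_digit; rewrite -addnn leq_addr.
by rewrite /=; arith_tac.
Qed.

(** * Counting the solutions of exponential equations *)

(* Exponential polynomials in the variables [v], with coefficients in [e]. *)
Inductive pexp : Type :=
| PCst of aterm
| PVar of nat
| PPow2 of nat
| PAdd of pexp & pexp
| PMul of pexp & pexp.

Fixpoint peval (P : pexp) (e : nat -> nat) (v : seq nat) : nat :=
  match P with
  | PCst c => aeval c e
  | PVar i => nth 0 v i
  | PPow2 i => 2 ^ nth 0 v i
  | PAdd P Q => peval P e v + peval Q e v
  | PMul P Q => peval P e v * peval Q e v
  end.

Fixpoint pshift (P : pexp) : pexp :=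
  match P with
  | PCst c => PCst c
  | PVar i => PVar i.+1
  | PPow2 i => PPow2 i.+1
  | PAdd P Q => PAdd (pshift P) (pshift Q)
  | PMul P Q => PMul (pshift P) (pshift Q)
  end.

Lemma peval_shift P e y v : peval (pshift P) e ((y : nat) :: v) = peval P e v.
Proof. by elim: P => //= [P -> Q ->|P -> Q ->]. Qed.

(* [P] as a sum of terms [y ^ a * 2 ^ (k * y) * Q], [y] the first variable. *)
Fixpoint psplit (P : pexp) : seq (nat * nat * pexp) :=
  match P with
  | PCst c => [:: (0, 0, PCst c)]
  | PVar 0 => [:: (1, 0, PCst (ACst 1))]
  | PVar i.+1 => [:: (0, 0, PVar i)]
  | PPow2 0 => [:: (0, 1, PCst (ACst 1))]
  | PPow2 i.+1 => [:: (0, 0, PPow2 i)]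
  | PAdd P Q => psplit P ++ psplit Q
  | PMul P Q => [seq (p.1.1 + q.1.1, p.1.2 + q.1.2, PMul p.2 q.2)
                | p <- psplit P, q <- psplit Q]
  end.

Lemma psplitE P e y v :
  peval P e ((y : nat) :: v) =
  \sum_(p <- psplit P) y ^ p.1.1 * (2 ^ p.1.2) ^ y * peval p.2 e v.
Proof.
elim: P => [c|[|i]|[|i]|P IHP Q IHQ|P IHP Q IHQ] /=;
  rewrite ?big_seq1 /= ?exp1n ?expn1 ?muln1 ?mul1n //.
- by rewrite big_cat /= IHP IHQ.
- rewrite IHP IHQ big_distrl /= big_allpairs_dep /=; apply: eq_bigr => p _.
  rewrite big_distrr /=; apply: eq_bigr => q _.
  by rewrite !expnD expnMn; lia.
Qed.

(** After [psplit] the first variable occurs only in factors [y ^ a * (2 ^ k * g e) ^ y], whose sums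
    are coefficients by [arith_power_sum]; what remains is an exponential polynomial in the other
    variables. The weight [g] keeps the base above 1 even for [k = 0]. *)
Lemma exists_psum P N g :
  arith N -> arith g -> (forall e, 1 < g e) ->
  exists P', forall e v,
    peval P' e v = \sum_(y < N e) g e ^ y * peval P e ((y : nat) :: v).
Proof.
move=> HN Hg g_gt1.
have [P' HP'] : exists P', forall e v, peval P' e v =
    \sum_(p <- psplit P) (\sum_(y < N e) y ^ p.1.1 * (2 ^ p.1.2 * g e) ^ y) * peval p.2 e v.
  elim: (psplit P) => [|p s [P' HP']].
    by exists (PCst (ACst 0)) => e v; rewrite big_nil.
  have [t Ht] : arith (fun e => \sum_(y < N e) y ^ p.1.1 * (2 ^ p.1.2 * g e) ^ y).
    apply: arith_power_sum => [//||e]; first by arith_tac.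
    by have := g_gt1 e; have := expn_gt0 2 p.1.2; nia.
  by exists (PAdd (PMul (PCst t) p.2) P') => e v; rewrite big_cons /= Ht HP'.
exists P' => e v; rewrite HP'.
under [RHS]eq_bigr => y _ do rewrite psplitE big_distrr /=.
rewrite exchange_big; apply: eq_bigr => p _ /=; rewrite big_distrl /=.
by apply: eq_bigr => y _; rewrite expnMn; lia.
Qed.

Section CubeSums.

Variable N : nat.

Fixpoint csum (m : nat) (F : seq nat -> nat) (v : seq nat) : nat :=
  if m is m'.+1 then \sum_(y < N) csum m' F ((y : nat) :: v) else F v.

(* The values of [F] on the cube, as the base [2 ^ Q] digits of one number. *)
Fixpoint wsum (Q m : nat) (F : seq nat -> nat) (v : seq nat) : nat :=
  if m is m'.+1
  then \sum_(y < N) (2 ^ (Q * N ^ m')) ^ y * wsum Q m' F ((y : nat) :: v)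
  else F v.

Definition in_cube (m : nat) (u : seq nat) := (size u == m) && all (fun x => x < N) u.

Lemma in_cube_rcons m u (y : 'I_N) : in_cube m u -> in_cube m.+1 (rcons u y).
Proof. by rewrite /in_cube size_rcons all_rcons eqSS ltn_ord. Qed.

Lemma eq_csum m F G v :
  (forall u, in_cube m u -> F (u ++ v) = G (u ++ v)) -> csum m F v = csum m G v.
Proof.
elim: m v => [|m IHm] v FG /=; first exact: (FG [::]).
apply: eq_bigr => y _; apply: IHm => u Hu.
by rewrite -cat_rcons; apply/FG/in_cube_rcons.
Qed.

Lemma csum_const m c v : csum m (fun=> c) v = N ^ m * c.
Proof.
elim: m v => [|m IHm] v /=; first by rewrite mul1n.
under eq_bigr => y _ do rewrite IHm.
by rewrite sum_nat_const card_ord expnS mulnA.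
Qed.

Lemma csumD m F G v :
  csum m (fun u => F u + G u) v = csum m F v + csum m G v.
Proof.
elim: m v => [//|m IHm] v /=; rewrite -big_split; apply: eq_bigr => y _.
exact: IHm.
Qed.

Lemma csumZ m c F v : csum m (fun u => c * F u) v = c * csum m F v.
Proof.
elim: m v => [//|m IHm] v /=; rewrite big_distrr; apply: eq_bigr => y _.
exact: IHm.
Qed.

Lemma wsumD Q m F G v :
  wsum Q m (fun u => F u + G u) v = wsum Q m F v + wsum Q m G v.
Proof.
elim: m v => [//|m IHm] v /=; rewrite -big_split; apply: eq_bigr => y _ /=.
by rewrite IHm mulnDr.
Qed.

Lemma wsumZ Q m c F v : wsum Q m (fun u => c * F u) v = c * wsum Q m F v.
Proof.
elim: m v => [//|m IHm] v /=; rewrite big_distrr; apply: eq_bigr => y _ /=.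
by rewrite IHm mulnCA.
Qed.

Lemma eq_wsum Q m F G v :
  (forall u, in_cube m u -> F (u ++ v) = G (u ++ v)) ->
  wsum Q m F v = wsum Q m G v.
Proof.
elim: m v => [|m IHm] v FG /=; first exact: (FG [::]).
apply: eq_bigr => y _; congr (_ * _); apply: IHm => u Hu.
by rewrite -cat_rcons; apply/FG/in_cube_rcons.
Qed.

Lemma hw_digits R n (Y : nat -> nat) :
  (forall y, y < n -> Y y < 2 ^ R) ->
  hw (\sum_(y < n) (2 ^ R) ^ y * Y y) = \sum_(y < n) hw (Y y).
Proof.
elim: n => [|n IHn] Y_lt; first by rewrite !big_ord0.
rewrite !big_ord_recr /= -expnM hw_cat.
  by rewrite IHn // => y /ltnW; apply: Y_lt.
rewrite expnM; under eq_bigr do rewrite mulnC.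
by apply: ltn_digits => y /ltnW; apply: Y_lt.
Qed.

Lemma hw_wsum Q m F v :
  (forall u, in_cube m u -> F (u ++ v) < 2 ^ Q) ->
  wsum Q m F v < 2 ^ (Q * N ^ m)
  /\ hw (wsum Q m F v) = csum m (fun u => hw (F u)) v.
Proof.
elim: m v => [|m IHm] v F_lt /=; first by rewrite muln1; split=> //; exact: (F_lt [::]).
have {}IHm (y : 'I_N) : wsum Q m F ((y : nat) :: v) < 2 ^ (Q * N ^ m)
    /\ hw (wsum Q m F ((y : nat) :: v)) = csum m (fun u => hw (F u)) ((y : nat) :: v).
  by apply: IHm => u Hu; rewrite -cat_rcons; apply/F_lt/in_cube_rcons.
have lt_w y : y < N -> wsum Q m F ((y : nat) :: v) < 2 ^ (Q * N ^ m).
  by move=> lt_y; case: (IHm (Ordinal lt_y)).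
split.
  rewrite expnSr mulnA [X in _ < X]expnM; under eq_bigr do rewrite [_ * wsum _ _ _ _]mulnC.
  exact: (ltn_digits (d := fun y => wsum Q m F (y :: v)) lt_w).
rewrite (hw_digits (Y := fun y => wsum Q m F ((y : nat) :: v))) //.
by apply: eq_bigr => y _; case: (IHm y).
Qed.

End CubeSums.

Lemma exists_pwsum P m N Q :
  arith N -> arith Q -> (forall e, 0 < N e) -> (forall e, 0 < Q e) ->
  exists P', forall e v, peval P' e v = wsum (N e) (Q e) m (peval P e) v.
Proof.
move=> HN HQ N_gt0 Q_gt0; elim: m => [|m [P' HP']]; first by exists P.
have [||P'' HP''] := @exists_psum P' _ (fun e => 2 ^ (Q e * N e ^ m)) HN.
- by arith_tac.
- move=> e; rewrite -[1]/(2 ^ 0) ltn_exp2l // muln_gt0 Q_gt0.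
  by rewrite expn_gt0 N_gt0.
exists P'' => e v; rewrite HP'' /=.
by apply: eq_bigr => y _; rewrite HP'.
Qed.

(** Without subtraction, exponential polynomials are monotone, so their value at a corner bounds
    them on the cube; this provides the digit size [q] of [arith_count]. *)
Lemma peval_leq P e m N u : in_cube N m u -> peval P e u <= peval P e (nseq m N).
Proof.
case/andP=> /eqP size_u /allP u_lt.
have nth_leq i : nth 0 u i <= nth 0 (nseq m N) i.
  rewrite nth_nseq; case: ltnP => [lt_im|le_mi]; last by rewrite nth_default ?size_u.
  by apply/ltnW/u_lt/mem_nth; rewrite size_u.
elim: P => //= [i|P IHP Q IHQ|P IHP Q IHQ]; first by rewrite leq_exp2l.
  exact: leq_add.
exact: leq_mul.
Qed.

Lemma arith_peval P m N : arith N -> arith (fun e => peval P e (nseq m (N e))).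
Proof.
move=> HN; have Hnth i : arith (fun e => nth 0 (nseq m (N e)) i).
  apply: (@eq_arith (fun e => if i < m then N e else 0)) => [e|].
    by rewrite nth_nseq.
  by case: (i < m) => //; arith_tac.
by elim: P => /= [c|i|i|P IHP Q IHQ|P IHP Q IHQ]; arith_tac; [exact: arith_aeval | exact: Hnth..].
Qed.

Definition holds (E : seq (pexp * pexp)) (e : nat -> nat) (v : seq nat) : bool :=
  all (fun p => peval p.1 e v == peval p.2 e v) E.

(* [sq_pos E - sq_neg E] is the sum of the squares of the differences. *)
Definition sq_pos (E : seq (pexp * pexp)) : pexp :=
  foldr (fun p => PAdd (PAdd (PMul p.1 p.1) (PMul p.2 p.2))) (PCst (ACst 0)) E.

Definition sq_neg (E : seq (pexp * pexp)) : pexp :=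
  foldr (fun p => PAdd (PMul (PCst (ACst 2)) (PMul p.1 p.2))) (PCst (ACst 0)) E.

Lemma sq_diff E e v :
  peval (sq_neg E) e v <= peval (sq_pos E) e v
  /\ (peval (sq_pos E) e v - peval (sq_neg E) e v == 0) = holds E e v.
Proof.
elim: E => [//|[P Q] E [le_E eq_E]] /=.
have := nat_Cauchy (peval P e v) (peval Q e v).
rewrite -!mulnn => -[le_PQ eq_PQ]; split; first exact: leq_add.
by rewrite -eq_PQ -eq_E; lia.
Qed.

Theorem arith_count m E N :
  arith N -> (forall e, 0 < N e) ->
  arith (fun e => csum (N e) m (fun v => holds E e v) [::]).
Proof.
move=> HN N_gt0.
pose q e := (peval (sq_pos E) e (nseq m (N e))).+1.
have Hq : arith q by apply/arith_succ/arith_peval.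
have HQ : arith (fun e => q e + q e) by arith_tac.
have Q_gt0 e : 0 < q e + q e by [].
have [A HA] := exists_pwsum (sq_pos E) m HN HQ N_gt0 Q_gt0.
have [B HB] := exists_pwsum (sq_neg E) m HN HQ N_gt0 Q_gt0.
(* The positive and negative parts are summed separately. Their difference is taken digit by digit,
   because [sq_neg E] never exceeds [sq_pos E]. The digits of [W e] are [(2 ^ q - 1) * X u], below
   [2 ^ (q + q)]. *)
pose W e := (2 ^ q e - 1) * (peval A e [::] - peval B e [::]).
have HW : arith W.
  have HA0 := @arith_peval A 0 _ HN; have HB0 := @arith_peval B 0 _ HN.
  by rewrite /W; arith_tac.
(* By [hw_mulM] each point that is not a solution contributes [q e] to the weight, so the quotient
   counts the points to discard. *)
apply: (@eq_arith (fun e => N e ^ m - hw (W e) %/ q e)) => [e|]; last first.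
  by have Hhw := arith_hw HW; arith_tac.
pose X v := peval (sq_pos E) e v - peval (sq_neg E) e v.
have X_lt u : in_cube (N e) m u -> X u < 2 ^ q e.
  move=> Hu; have := peval_leq (sq_pos E) e Hu.
  by have := ltn_expl (q e) (ltnSn 1); rewrite /X /q; lia.
have WE : W e = wsum (N e) (q e + q e) m (fun u => (2 ^ q e - 1) * X u) [::].
  rewrite wsumZ /W HA HB; congr (_ * _).
  set F := peval (sq_neg E) e.
  have -> : wsum (N e) (q e + q e) m (peval (sq_pos E) e) [::]
     = wsum (N e) (q e + q e) m (fun u => X u + F u) [::].
    by apply: eq_wsum => u _; rewrite subnK //; case: (sq_diff E e (u ++ [::])).
  by rewrite wsumD addnK.
have -> : hw (W e) = q e * csum (N e) m (fun v => ~~ holds E e v) [::].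
  rewrite WE; have [|_ ->] := @hw_wsum (N e) (q e + q e) m (fun u => (2 ^ q e - 1) * X u) [::].
    move=> u; rewrite cats0 => /X_lt X_u; rewrite expnD.
    by have := expn_gt0 2 (q e); nia.
  rewrite -csumZ; apply: eq_csum => u; rewrite cats0 => /X_lt X_u.
  by rewrite hw_mulM // -(proj2 (sq_diff E e u)).
rewrite mulKn // -[N e ^ m]muln1 -(csum_const _ _ _ [::]).
rewrite (_ : csum _ _ (fun=> 1) _ = csum (N e) m (fun v => holds E e v + ~~ holds E e v) [::]).
  by rewrite csumD addnK.
by apply: eq_csum => u _; case: (holds _ _ _).
Qed.

(** * Bounded sums, products and recursion *)

(* Each block of equations constrains a new variable, pushed on the list. *)
Fixpoint solutions (N : nat) (e : nat -> nat) (p : seq (seq (pexp * pexp)))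
    (v : seq nat) : nat :=
  if p is E :: p' then
    \sum_(y < N) holds E e ((y : nat) :: v) * solutions N e p' ((y : nat) :: v)
  else 1.

Definition eqs_shift (E : seq (pexp * pexp)) :=
  [seq (pshift q.1, pshift q.2) | q <- E].

Fixpoint eqs_of (E : seq (pexp * pexp)) (p : seq (seq (pexp * pexp))) :=
  if p is E' :: p' then eqs_of (eqs_shift E ++ E') p' else E.

Lemma holds_shift E e y v : holds (eqs_shift E) e (y :: v) = holds E e v.
Proof.
by rewrite /holds all_map; apply: eq_all => q /=; rewrite !peval_shift.
Qed.

(** All the equations can wait until the last variable has been pushed, which gives the single
    system required by [arith_count]. *)
Lemma csum_eqs_of N e E p v :
  csum N (size p) (fun u => holds (eqs_of E p) e u) v
  = holds E e v * solutions N e p v.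
Proof.
elim: p E v => [|E' p IHp] E v /=; first by rewrite muln1.
rewrite big_distrr; apply: eq_bigr => y _ /=.
by rewrite IHp /holds all_cat -/(holds _ _ _) holds_shift -mulnb mulnA.
Qed.

Lemma arith_count_prog p N :
  arith N -> (forall e, 0 < N e) -> arith (fun e => solutions (N e) e p [::]).
Proof.
move=> HN N_gt0; apply: eq_arith (arith_count (size p) (eqs_of [::] p) HN N_gt0).
by move=> e; rewrite csum_eqs_of mul1n.
Qed.

Lemma sum_delta N c (F : nat -> nat) :
  c < N -> \sum_(y < N) (y == c :> nat) * F y = F c.
Proof.
move=> lt_c; rewrite (bigD1 (Ordinal lt_c)) //= eqxx mul1n big1 ?addn0 // => y.
by rewrite -val_eqE /= => /negbTE ->.
Qed.

Lemma count_push N e E p v c :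
  c < N -> (forall y, y < N -> holds E e (y :: v) = (y == c)) ->
  solutions N e (E :: p) v = solutions N e p (c :: v).
Proof.
move=> lt_c HE /=; rewrite -(sum_delta (fun y => solutions N e p (y :: v)) lt_c).
by apply: eq_bigr => y _; rewrite HE.
Qed.

(** An empty block pushes a variable that only the next nonempty block constrains: here the opposite
    difference in a truncated subtraction, and in [count_push3] the remainder of a division and its
    slack. *)
Lemma count_push2 N e E p v s0 c :
  s0 < N -> c < N ->
  (forall s y, s < N -> y < N -> holds E e [:: y, s & v] = (s == s0) && (y == c)) ->
  solutions N e [:: [::], E & p] v = solutions N e p [:: c, s0 & v].
Proof.
move=> lt_s lt_c HE.
rewrite -(sum_delta (fun s => solutions N e p [:: c, s & v]) lt_s) /=.
apply: eq_bigr => s _; rewrite mul1n.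
rewrite -(sum_delta (fun y => solutions N e p [:: y, (s : nat) & v]) lt_c) big_distrr /=.
by apply: eq_bigr => y _; rewrite HE // -mulnb mulnA.
Qed.

Lemma count_push3 N e E p v r0 s0 c :
  r0 < N -> s0 < N -> c < N ->
  (forall r s y, r < N -> s < N -> y < N ->
     holds E e [:: y, s, r & v] = [&& r == r0, s == s0 & y == c]) ->
  solutions N e [:: [::], [::], E & p] v = solutions N e p [:: c, s0, r0 & v].
Proof.
move=> lt_r lt_s lt_c HE.
rewrite -(sum_delta (fun r => solutions N e p [:: c, s0, r & v]) lt_r).
transitivity (\sum_(r < N) solutions N e [:: [::], E & p] ((r : nat) :: v)).
  by apply: eq_bigr => r _; rewrite mul1n.
apply: eq_bigr => r _; case: eqP => [->|ne_r].
  rewrite mul1n; apply: count_push2 => // s y lt_s' lt_y.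
  by rewrite HE // eqxx.
rewrite mul0n /=; apply: big1 => s _; rewrite mul1n; apply: big1 => y _.
by rewrite HE //; case: eqP.
Qed.

(* Pushes the value of [t] on the list, for the environment [scons i e] where
   [i] is at position [d]. *)
Fixpoint compile (t : aterm) (d : nat) : seq (seq (pexp * pexp)) :=
  match t with
  | AVar 0 => [:: [:: (PVar 0, PVar d.+1)]]
  | AVar k.+1 => [:: [:: (PVar 0, PCst (AVar k))]]
  | ACst c => [:: [:: (PVar 0, PCst (ACst c))]]
  | AAdd t u =>
    let p := compile t d in let q := compile u (size p + d) in
    p ++ q ++ [:: [:: (PVar 0, PAdd (PVar (size q).+1) (PVar 1))]]
  | ASub t u =>
    let p := compile t d in let q := compile u (size p + d) in
    p ++ q ++ [:: [::];
      [:: (PAdd (PVar 1) (PVar (size q).+2), PAdd (PVar 2) (PVar 0));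
          (PMul (PVar 1) (PVar 0), PCst (ACst 0))]]
  | AMul t u =>
    let p := compile t d in let q := compile u (size p + d) in
    p ++ q ++ [:: [:: (PVar 0, PMul (PVar (size q).+1) (PVar 1))]]
  | ADivS t u =>
    let p := compile t d in let q := compile u (size p + d) in
    p ++ q ++ [:: [::]; [::];
      [:: (PVar (size q).+3, PAdd (PMul (PVar 0) (PAdd (PVar 3) (PCst (ACst 1)))) (PVar 2));
          (PAdd (PVar 2) (PVar 1), PVar 3)]]
  | APow2 t =>
    let p := compile t d in p ++ [:: [:: (PVar 0, PPow2 1)]]
  end.

(* Bounds all the subterms of [t], and is monotone. *)
Fixpoint abound (t : aterm) : aterm :=
  match t with
  | AVar k => AVar k
  | ACst c => ACst c
  | AAdd u v | ASub u v | ADivS u v => AAdd (abound u) (abound v)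
  | AMul u v => AAdd (AMul (abound u) (abound v)) (AAdd (abound u) (abound v))
  | APow2 u => APow2 (abound u)
  end.

Lemma aeval_bound t e : aeval t e <= aeval (abound t) e.
Proof.
elim: t => //= [u Hu v Hv|u Hu v Hv|u Hu v Hv|u Hu v Hv|u Hu].
- exact: leq_add.
- lia.
- by apply: leq_trans (leq_addr _ _); apply: leq_mul.
- by apply: leq_trans (leq_div _ _) _; lia.
- by rewrite leq_exp2l.
Qed.

Lemma aeval_bound_mono t e e' :
  (forall k, e k <= e' k) -> aeval (abound t) e <= aeval (abound t) e'.
Proof.
move=> ee'; elim: t => //= [u Hu v Hv|u Hu v Hv|u Hu v Hv|u Hu v Hv|u Hu];
  rewrite ?leq_add ?leq_mul //.
by rewrite leq_exp2l.
Qed.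

Lemma nth_push (s : seq nat) v k : nth 0 (s ++ v) (size s + k) = nth 0 v k.
Proof. by rewrite nth_cat ltnNge leq_addr /= addKn. Qed.

(** [w] lists the intermediate values. It does not depend on [p] and [v], so that the codes of
    subterms can be chained, and the number of solutions is preserved. *)
Definition pushes N e i t :=
  forall d, aeval (abound t) (scons i e) < N ->
  exists w, size (compile t d) = (size w).+1 /\
    forall p v, nth 0 v d = i ->
    solutions N e (compile t d ++ p) v
    = solutions N e p (aeval t (scons i e) :: w ++ v).

Lemma pushes2 N e i t u d :
  pushes N e i t -> pushes N e i u ->
  aeval (abound t) (scons i e) + aeval (abound u) (scons i e) < N ->
  let q := compile u (size (compile t d) + d) in
  exists wt wu, [/\ size (compile t d) = (size wt).+1, size q = (size wu).+1 &
    forall p v, nth 0 v d = i ->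
    solutions N e (compile t d ++ q ++ p) v
    = solutions N e p (aeval u (scons i e) :: wu ++ aeval t (scons i e) :: wt ++ v)].
Proof.
move=> Pt Pu lt_N /=.
have [|wt [szt Ht]] := Pt d; first by lia.
have [|wu [szu Hu]] := Pu (size (compile t d) + d); first by lia.
exists wt, wu; split=> // p v d_i; rewrite Ht // Hu // szt -d_i.
exact: (nth_push (_ :: wt)).
Qed.

Lemma nth_cat_size (s : seq nat) x v : nth 0 (s ++ x :: v) (size s) = x.
Proof. by rewrite nth_cat ltnn subnn. Qed.

Lemma compileP N e i t : pushes N e i t.
Proof.
elim: t => [[|k]|c|t IHt u IHu|t IHt u IHu|t IHt u IHu|t IHt u IHu|t IHt] d lt_N.
- exists [::]; split=> // p v d_i; rewrite [compile _ _ ++ p]/=.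
  by apply: count_push => // y _; rewrite /holds /= d_i andbT.
- exists [::]; split=> // p v d_i; rewrite [compile _ _ ++ p]/=.
  by apply: count_push => // y _; rewrite /holds /= andbT.
- exists [::]; split=> // p v d_i; rewrite [compile _ _ ++ p]/=.
  by apply: count_push => // y _; rewrite /holds /= andbT.
- have := aeval_bound (AAdd t u) (scons i e); move: lt_N => /= lt_N le_N.
  have [wt [wu [szt szu Hp]]] := pushes2 d IHt IHu lt_N.
  exists (aeval u (scons i e) :: wu ++ aeval t (scons i e) :: wt).
  split=> [|p v d_i]; first by rewrite /= !size_cat szu szt /= ?size_cat /=; lia.
  rewrite -!catA Hp // szu [_ ++ p]/= !cat_cons -catA; apply: count_push => [|y _]; first by lia.
  by rewrite /holds /= nth_cat_size andbT.
- have := aeval_bound t (scons i e); have := aeval_bound u (scons i e).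
  move: lt_N => /= lt_N le_u le_t.
  have [wt [wu [szt szu Hp]]] := pushes2 d IHt IHu lt_N.
  move: Hp le_u le_t; set a := aeval t _; set b := aeval u _ => Hp le_u le_t.
  (* The equations [s + a = b + y] and [s * y = 0] force [y = a - b] and [s = b - a]. *)
  exists [:: b - a, b & wu ++ a :: wt].
  split=> [|p v d_i]; first by rewrite /= !size_cat szu szt /= ?size_cat /=; lia.
  rewrite -!catA Hp // szu [_ ++ p]/= !cat_cons -catA; apply: 
    count_push2 => [||s y _ _]; try by lia.
  rewrite /holds /= nth_cat_size andbT.
  by apply/andP/andP => -[/eqP E1 /eqP E2]; split; apply/eqP; nia.
- have := aeval_bound (AMul t u) (scons i e); move: lt_N => /= lt_N le_N.
  have lt_N' : aeval (abound t) (scons i e) + aeval (abound u) (scons i e) < N by lia.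
  have [wt [wu [szt szu Hp]]] := pushes2 d IHt IHu lt_N'.
  exists (aeval u (scons i e) :: wu ++ aeval t (scons i e) :: wt).
  split=> [|p v d_i]; first by rewrite /= !size_cat szu szt /= ?size_cat /=; lia.
  rewrite -!catA Hp // szu [_ ++ p]/= !cat_cons -catA; apply: count_push => [|y _]; first by lia.
  by rewrite /holds /= nth_cat_size andbT.
- have := aeval_bound t (scons i e); have := aeval_bound u (scons i e).
  have := aeval_bound (ADivS t u) (scons i e).
  move: lt_N => /= lt_N le_d le_u le_t.
  have [wt [wu [szt szu Hp]]] := pushes2 d IHt IHu lt_N.
  move: Hp le_d le_u le_t; set a := aeval t _; set b := aeval u _ => Hp le_d le_u le_t.
  have lt_r : a %% b.+1 < b.+1 := ltn_pmod a (ltn0Sn b).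
  (* The equations are [a = y * b.+1 + r] and [r + s = b], the slack [s] expressing that
     [r <= b]. *)
  exists [:: b - a %% b.+1, a %% b.+1, b & wu ++ a :: wt].
  split=> [|p v d_i]; first by rewrite /= !size_cat szu szt /= ?size_cat /=; lia.
  rewrite -!catA Hp // szu [_ ++ p]/= !cat_cons -catA.
  apply: count_push3 => [|||r s y _ _ _]; try by lia.
  rewrite /holds /= nth_cat_size andbT addn1.
  apply/andP/and3P => [[/eqP E1 /eqP E2]|[/eqP E1 /eqP E2 /eqP E3]].
    have [Ey Er] : y = a %/ b.+1 /\ r = a %% b.+1.
      by rewrite E1 divnMDl // modnMDl divn_small ?modn_small ?addn0 //; lia.
    by rewrite Ey -Er !eqxx; split=> //; apply/eqP; lia.
  by rewrite E1 E2 E3 -divn_eq eqxx; split=> //; apply/eqP; lia.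
- have := aeval_bound (APow2 t) (scons i e).
  move: lt_N => /= lt_N le_N.
  have [|wt [szt Ht]] := IHt d.
    by apply: leq_ltn_trans lt_N; apply/ltnW/ltn_expl.
  exists (aeval t (scons i e) :: wt).
  split=> [|p v d_i]; first by rewrite size_cat szt /= addn1.
  rewrite -catA Ht // [_ ++ p]/=; apply: count_push => [|y _]; first by lia.
  by rewrite /holds /= andbT.
Qed.

(** An inequality must be given as an equation; its slack [s] is unique, so the count does not
    change. *)
Lemma sum_lt N n (F : nat -> nat) :
  n <= N ->
  \sum_(i < N) \sum_(s < N) (i + s.+1 == n :> nat) * F i = \sum_(i < n) F i.
Proof.
move=> le_nN; rewrite (big_ord_widen N F le_nN) [RHS]big_mkcond.
apply: eq_bigr => i _ /=; case: ltnP => [lt_in|le_ni].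
  have lt_s : n - i.+1 < N by lia.
  rewrite -[RHS](sum_delta (fun=> F i) lt_s); apply: eq_bigr => s _.
  by have -> : (i + s.+1 == n :> nat) = (s == n - i.+1 :> nat) by lia.
by apply: big1 => s _; have -> : (i + s.+1 == n :> nat) = false by lia.
Qed.

(* Counts the [(i, j)] with [i < n] and [j < t]. *)
Definition sum_prog (t n : aterm) : seq (seq (pexp * pexp)) :=
  [:: [::]; [:: (PAdd (PVar 1) (PAdd (PVar 0) (PCst (ACst 1))), PCst n)]]
  ++ compile t 1
  ++ [:: [::]; [:: (PAdd (PVar 1) (PAdd (PVar 0) (PCst (ACst 1))), PVar 2)]].

Lemma count_sum_prog N e t n :
  aeval n e < N -> aeval (abound t) (scons (aeval n e) e) < N ->
  solutions N e (sum_prog t n) [::] = \sum_(i < aeval n e) aeval t (scons (i : nat) e).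
Proof.
move=> lt_n lt_t; rewrite /sum_prog -(sum_lt (fun i => aeval t (scons i e)) (ltnW lt_n)).
rewrite [_ ++ compile t 1 ++ _]/= [LHS]/=.
apply: eq_bigr => i _; rewrite mul1n; apply: eq_bigr => s _.
rewrite andbT addn1; case: eqP => [i_lt|_]; rewrite ?mul0n ?mul1n //.
have lt_it : aeval (abound t) (scons (i : nat) e) < N.
  by apply: leq_ltn_trans lt_t; apply: aeval_bound_mono => -[|k] //=; lia.
have [w [_ ->//]] := @compileP N e i t 1 lt_it.
have le_v := leq_ltn_trans (aeval_bound t (scons (i : nat) e)) lt_it.
rewrite -[RHS]muln1 -{2}[aeval t _]card_ord -sum_nat_const.
rewrite -(sum_lt (fun=> 1) (ltnW le_v)) /=.
apply: eq_bigr => j _; rewrite mul1n; apply: eq_bigr => r _.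
by rewrite /holds /= andbT addn1.
Qed.

Theorem arith_sum n (F : nat -> (nat -> nat) -> nat) :
  arith n -> arith (fun e => F (e 0) (fun k => e k.+1)) ->
  arith (fun e => \sum_(i < n e) F i e).
Proof.
move=> [tn Hn] [t Ht].
(* As [abound t] is monotone, its value at [n e] bounds the values of all the subterms for every
   [i < n e], and one cube contains all the solutions. *)
pose N e := (n e + aeval (abound t) (scons (n e) e)).+1.
have HN : arith N.
  have Hb : arith (fun e => aeval (abound t) (scons (n e) e)).
    exists (asubst (scons tn AVar) (abound t)) => e; rewrite aeval_subst.
    by apply: eq_aeval => -[|k] /=.
  have Hn' : arith n by exists tn.
  by rewrite /N; arith_tac.
apply: eq_arith (arith_count_prog (sum_prog t tn) HN _) => // e.
rewrite count_sum_prog ?Hn /N; try lia.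
by apply: eq_bigr => i _; rewrite Ht.
Qed.

Lemma digits_of n b h :
  h < b ^ n -> h = \sum_(i < n) (h %/ b ^ i %% b) * b ^ i.
Proof.
elim: n h => [|n IHn] h; first by rewrite big_ord0 expn0; case: h.
rewrite expnSr => lt_h; have b_gt0 : 0 < b by case: (b) lt_h; rewrite ?muln0.
rewrite (digits_recl n (fun i => h %/ b ^ i %% b)) divn1 {1}(divn_eq h b).
have /IHn E : h %/ b < b ^ n by rewrite ltn_divLR.
rewrite {1}E; congr (_ * _ + _); apply: eq_bigr => i _.
by rewrite -divnMA -expnS.
Qed.

(* The only [h] coding the sequence of the iterates is found by a sum. *)
Lemma arith_iteri (n x B : (nat -> nat) -> nat) (F : nat -> nat -> (nat -> nat) -> nat) :
  arith n -> arith x -> arith B ->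
  arith (fun e => F (e 0) (e 1) (fun k => e k.+2)) ->
  exists2 G, arith G & forall e,
    (forall i, i <= n e -> iteri i (fun j a => F j a e) (x e) < B e) ->
    G e = iteri (n e) (fun j a => F j a e) (x e).
Proof.
move=> Hn Hx HB HF.
(* The universal statement that each digit of [h] follows from the previous one becomes the
   vanishing of a sum, to which [arith_sum] applies. *)
pose bad e h := \sum_(i < n e)
  ~~ (h %/ B e ^ i.+1 %% B e == F i (h %/ B e ^ i %% B e) e).
exists (fun e => \sum_(h < B e ^ (n e).+1)
  (((h : nat) %% B e == x e) && (bad e h == 0)) * (h %/ B e ^ n e %% B e)).
  apply: (arith_sum (F := fun h e =>
    ((h %% B e == x e) && (bad e h == 0)) * (h %/ B e ^ n e %% B e))).
    by arith_tac.
  have Hn1 := arith_shift 1 Hn; have HB1 := arith_shift 1 HB.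
  have Hx1 := arith_shift 1 Hx.
  have HB2 := arith_shift 2 HB.
  rewrite /bad; arith_tac.
  apply: (arith_sum (F := fun i e =>
    ~~ (e 0 %/ B (fun k => e k.+1) ^ i.+1 %% B (fun k => e k.+1)
      == F i (e 0 %/ B (fun k => e k.+1) ^ i %% B (fun k => e k.+1)) (fun k => e k.+1)))).
    exact: Hn1.
  have Hd : arith (fun e => e 1 %/ B (fun k => e k.+2) ^ e 0 %% B (fun k => e k.+2)).
    by arith_tac.
  have HFd := arith_open2 2 HF (arith_var 0) Hd.
  by arith_tac.
move=> e lt_B; set v := fun i => iteri i (fun j a => F j a e) (x e) in lt_B *.
pose hist := \sum_(i < (n e).+1) v i * B e ^ i.
have hist_lt : hist < B e ^ (n e).+1 by apply: ltn_digits => i; apply: lt_B.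
have histE i : i <= n e -> hist %/ B e ^ i %% B e = v i.
  by move=> le_i; apply: digitE => // j; apply: lt_B.
rewrite -[RHS]/(v (n e)) -(histE _ (leqnn _)).
rewrite -(sum_delta (fun h => h %/ B e ^ n e %% B e) hist_lt).
apply: eq_bigr => h _; congr ((_ : bool) * _).
apply/andP/eqP => [[/eqP h_x]|->].
  rewrite sum_nat_eq0 => /forallP /= h_F.
  have hE i : i <= n e -> h %/ B e ^ i %% B e = v i.
    elim: i => [_|i IHi lt_i]; first by rewrite divn1.
    have := h_F (Ordinal lt_i); rewrite /= eqb0 negbK => /eqP->.
    by rewrite IHi // ltnW.
  rewrite (digits_of (ltn_ord h)) (digits_of hist_lt).
  by apply: eq_bigr => i _; rewrite hE -1?ltnS // histE -1?ltnS.
split; first by rewrite -[hist]divn1 -[1]/(B e ^ 0) histE.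
rewrite sum_nat_eq0; apply/forallP => i /=.
by rewrite eqb0 negbK histE // histE // ltnW.
Qed.

Lemma arith_prod n (F : nat -> (nat -> nat) -> nat) :
  arith n -> arith (fun e => F (e 0) (fun k => e k.+1)) ->
  arith (fun e => \prod_(i < n e) F i e).
Proof.
move=> Hn HF; have HS := arith_sum Hn HF.
(* Each factor is at most the sum of all of them, and the [+ 1] keeps the base positive, so that
   every partial product is below [B e]. *)
pose B e := (\sum_(i < n e) F i e + 1) ^ n e + 1.
have HB : arith B by rewrite /B; arith_tac.
have HG : arith (fun e => e 1 * F (e 0) (fun k => e k.+2)).
  apply: arith_mul; first exact: arith_var.
  by have [t Ht] := HF; exists (asubst (scons (AVar 0) (fun k => AVar k.+2)) t) => e;
     rewrite aeval_subst Ht.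
have [G HGa HGE] := @arith_iteri n (fun=> 1) B (fun i a e => a * F i e) Hn (arith_const 1) HB HG.
have iterE e m : iteri m (fun j a => a * F j e) 1 = \prod_(i < m) F i e.
  by elim: m => [|m IHm]; rewrite ?big_ord0 // big_ord_recr /= IHm.
apply: eq_arith HGa => e; rewrite HGE ?iterE // => i le_i.
rewrite iterE /B addn1 ltnS.
set S := \sum_(j < n e) _ + 1.
apply: (@leq_trans (S ^ i)); last by apply: leq_pexp2l; rewrite ?/S ?addn1.
rewrite -[i in S ^ i]card_ord -prod_nat_const; apply: leq_prod => j _.
have lt_j : j < n e by apply: leq_trans le_i.
by rewrite /S (bigD1 (Ordinal lt_j)) //=; lia.
Qed.

(** * Simulation of Turing machines *)

Lemma arith_app5 (F : nat -> nat -> nat -> nat -> nat -> nat) f1 f2 f3 f4 f5 :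
  arith (fun e => F (e 0) (e 1) (e 2) (e 3) (e 4)) ->
  arith f1 -> arith f2 -> arith f3 -> arith f4 -> arith f5 ->
  arith (fun e => F (f1 e) (f2 e) (f3 e) (f4 e) (f5 e)).
Proof.
move=> [u Hu] [t1 H1] [t2 H2] [t3 H3] [t4 H4] [t5 H5].
exists (asubst (scons t1 (scons t2 (scons t3 (scons t4 (fun=> t5))))) u) => e.
by rewrite aeval_subst Hu /= H1 H2 H3 H4 H5.
Qed.

Lemma cantor_inj x y x' y' : cantor x y = cantor x' y' -> x = x' /\ y = y'.
Proof.
rewrite /cantor; move: (x + y) (x' + y') (leq_addl x y) (leq_addl x' y') (addnK y x) (addnK y' x').
have tri_lt m n : m < n -> m * m.+1 %/ 2 + m < n * n.+1 %/ 2.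
  by move=> lt_mn; have : m.+1 * m.+2 <= n * n.+1 by [apply: leq_mul]; nia.
move=> s s' le_ys le_ys' <- <- E.
case: (ltngtP s s') => [/tri_lt|/tri_lt|ss']; [lia|lia|].
by move: E; rewrite ss' => /addnI <-.
Qed.

Lemma leq_cantor x y : x <= cantor x y /\ y <= cantor x y.
Proof. rewrite /cantor; nia. Qed.

(** Unpairing by exhaustive search: coordinates do not exceed their code, and by injectivity only
    one pair contributes. *)
Definition unpair1 (C : nat) : nat :=
  \sum_(x < C.+1) \sum_(y < C.+1) (cantor x y == C) * x.

Definition unpair2 (C : nat) : nat :=
  \sum_(x < C.+1) \sum_(y < C.+1) (cantor x y == C) * y.

Lemma sum_cantor x y (F : nat -> nat -> nat) :
  \sum_(x' < (cantor x y).+1) \sum_(y' < (cantor x y).+1)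
    (cantor x' y' == cantor x y) * F x' y' = F x y.
Proof.
have [le_x le_y] := leq_cantor x y.
rewrite -(sum_delta (fun x' => F x' y) (le_x : x < (cantor x y).+1)).
apply: eq_bigr => x' _.
rewrite -(sum_delta (F x') (le_y : y < (cantor x y).+1)) big_distrr.
apply: eq_bigr => y' _ /=; rewrite mulnA mulnb; congr ((_ : bool) * _).
by apply/eqP/andP => [/cantor_inj[-> ->]|[/eqP-> /eqP->]].
Qed.

Lemma unpair1K x y : unpair1 (cantor x y) = x.
Proof. exact: (sum_cantor x y (fun x _ => x)). Qed.

Lemma unpair2K x y : unpair2 (cantor x y) = y.
Proof. exact: (sum_cantor x y (fun _ y => y)). Qed.

Lemma arith_unpair1 : arith (fun e => unpair1 (e 0)).
Proof.
rewrite /unpair1; apply: (arith_sum (F := fun x e =>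
  \sum_(y < (e 0).+1) (cantor x y == e 0) * x)); first by arith_tac.
apply: (arith_sum (F := fun y e => (cantor (e 0) y == e 1) * e 0)); first by arith_tac.
by rewrite /cantor; arith_tac.
Qed.

Lemma arith_unpair2 : arith (fun e => unpair2 (e 0)).
Proof.
rewrite /unpair2; apply: (arith_sum (F := fun x e =>
  \sum_(y < (e 0).+1) (cantor x y == e 0) * y)); first by arith_tac.
apply: (arith_sum (F := fun y e => (cantor (e 0) y == e 1) * y)); first by arith_tac.
by rewrite /cantor; arith_tac.
Qed.

Definition digit (b P k : nat) : nat := P %/ b ^ k %% b.

(* Digit [i] of the instruction of [P] for the state and letter digits [q], [u]. *)
Definition lookup (b P q u i : nat) : nat :=
  \sum_(j < P) ((digit b P (5 * j) == q) && (digit b P (5 * j + 1) == u))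
    * digit b P (5 * j + i).

Lemma arith_lookup : arith (fun e => lookup (e 0) (e 1) (e 2) (e 3) (e 4)).
Proof.
rewrite /lookup; apply: (arith_sum (F := fun j e =>
  ((digit (e 0) (e 1) (5 * j) == e 2) && (digit (e 0) (e 1) (5 * j + 1) == e 3))
    * digit (e 0) (e 1) (5 * j + e 4))); first by arith_tac.
by rewrite /digit; arith_tac.
Qed.

(* The configuration with state digit [q], head [h] and tape number [w], whose
   base [b] digits are [2 ^ g - 1] for the letters [g], so that blanks are 0. *)
Definition pack (K w h q : nat) : nat := (w * K + h) * K + q.

(** [u.+1] turns the tape digit [2 ^ g - 1] into the letter digit [2 ^ g] of the program, and the
    move digits 2 and 4 stand for right and left. The new letter is added before the old one is
    removed, which keeps the truncated subtraction exact. *)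
Definition nstep (b P K k : nat) : nat :=
  let q := k %% K in let h := k %/ K %% K in let w := k %/ K %/ K in
  let u := digit b w h in
  pack K (w + (lookup b P q u.+1 3 - 1) * b ^ h - u * b ^ h)
    (h + (lookup b P q u.+1 4 == 2) - (lookup b P q u.+1 4 == 4))
    (lookup b P q u.+1 2).

Lemma arith_nstep : arith (fun e => nstep (e 0) (e 1) (e 2) (e 3)).
Proof.
have Hu : arith (fun e => (digit (e 0) (e 3 %/ e 2 %/ e 2) (e 3 %/ e 2 %% e 2)).+1).
  by rewrite /digit; arith_tac.
have Hq : arith (fun e => e 3 %% e 2) by arith_tac.
have Hl i := arith_app5 arith_lookup (arith_var 0) (arith_var 1) Hq Hu (arith_const i).
have := (Hl 2, Hl 3, Hl 4) => -[[Hl2 Hl3] Hl4].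
by rewrite /nstep /pack; arith_tac; rewrite /digit; arith_tac.
Qed.

(** The number of a block of strokes: the stroke is letter 1, whose tape digit is
    [2 ^ 1 - 1 = 1]. *)
Definition ones (b n : nat) : nat := \sum_(i < n) b ^ i.

Definition input_num (b : nat) (a : seq nat) : nat :=
  foldr (fun x r => ones b x.+1 + b ^ x.+2 * r) 0 a.

Definition input_len (a : seq nat) : nat := foldr (fun x r => x.+2 + r) 0 a.

Lemma arith_ones b n : arith b -> arith n -> arith (fun e => ones (b e) (n e)).
Proof.
move=> Hb Hn; apply: (arith_sum (F := fun i e => b e ^ i)) => //.
by have Hb1 := arith_shift 1 Hb; arith_tac.
Qed.

Lemma arith_input_num b m s :
  arith b -> arith (fun e => input_num (b e) [seq e k | k <- iota m s]).
Proof.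
move=> Hb; elim: s m => [|s IHs] m /=; first by arith_tac.
have Hs := IHs m.+1; have Ho := arith_ones Hb (arith_succ (arith_var m)).
by arith_tac.
Qed.

Lemma arith_input_len m s : arith (fun e => input_len [seq e k | k <- iota m s]).
Proof.
by elim: s m => [|s IHs] m /=; arith_tac; apply: IHs.
Qed.

(* The output [n] is written with [n.+1] strokes, as the number [ones b n.+1]. *)
Definition output_val (b w : nat) : nat := \sum_(j < w) (b ^ j.+1 <= w).

Lemma output_val_ones b n : 1 < b -> output_val b (ones b n.+1) = n.
Proof.
move=> b_gt1; set w := ones b n.+1.
have lt_w : w < b ^ n.+1.
  rewrite /w /ones; under eq_bigr do rewrite -[b ^ _]mul1n.
  exact: (ltn_digits (d := fun=> 1)).
have le_w : b ^ n <= w by rewrite /w /ones big_ord_recr /= leq_addl.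
have le_nw : n <= w by apply: leq_trans le_w; apply/ltnW/ltn_expl.
rewrite /output_val -[RHS]muln1 -[n in RHS]card_ord -sum_nat_const.
rewrite (big_ord_widen w (fun=> 1) le_nw) [RHS]big_mkcond; apply: eq_bigr => j _ /=.
case: ltnP => [lt_jn|le_nj].
  by rewrite (leq_trans _ le_w) // leq_exp2l.
by rewrite leqNgt (leq_trans lt_w) // leq_exp2l.
Qed.

(** For an arbitrary number [e 0] the iterates of [nstep] obey no bound, hence the premise. In a run
    of an encoded machine, [K] exceeds all state digits and head positions, and
    [input_len a + T + 1] cells are enough for [T] steps. *)
Lemma exists_upsilon s :
  exists2 U, arith U & forall e,
    let b := 2 ^ unpair1 (e 0) in
    let P := unpair2 (e 0) in
    let a := [seq e k | k <- iota 1 s] in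
    let T := e s.+1 in
    let K := b + T + 1 in
    let it i := iter i (nstep b P K) (pack K (input_num b a) 0 1) in
    (forall i, i <= T -> it i < b ^ (input_len a + T + 1) * K * K) ->
    U e = output_val b (it T %/ K %/ K).
Proof.
pose b e := 2 ^ unpair1 (e 0).
pose P e := unpair2 (e 0).
pose K e := b e + e s.+1 + 1.
have Hb : arith b by exact: arith_pow2 arith_unpair1.
have HP : arith P by exact: arith_unpair2.
have HK : arith K by rewrite /K; arith_tac.
have Hx : arith (fun e => pack (K e) (input_num (b e) [seq e k | k <- iota 1 s]) 0 1).
  by have := arith_input_num 1 s Hb; rewrite /pack => Hi; arith_tac.
have HB : arith (fun e => b e ^ (input_len [seq e k | k <- iota 1 s] + e s.+1 + 1) * K e * K e).
  by have Hl := arith_input_len 1 s; arith_tac.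
pose F (i k : nat) e := nstep (b e) (P e) (K e) k.
have HF : arith (fun e => F (e 0) (e 1) (fun k => e k.+2)).
  have [t Ht] := arith_nstep.
  have [[tb Htb] [tP HtP] [tK HtK]] :=
    And3 (arith_shift 2 Hb) (arith_shift 2 HP) (arith_shift 2 HK).
  exists (asubst (scons tb (scons tP (scons tK (fun=> AVar 1)))) t) => e.
  by rewrite aeval_subst Ht /= Htb HtP HtK.
have [G HG GE] := arith_iteri (arith_var s.+1) Hx HB HF.
exists (fun e => output_val (b e) (G e %/ K e %/ K e)).
  rewrite /output_val; apply: (arith_sum (F := fun j e =>
    b e ^ j.+1 <= G e %/ K e %/ K e)); first by arith_tac.
  have Hb1 := arith_shift 1 Hb; have HG1 := arith_shift 1 HG.
  by have HK1 := arith_shift 1 HK; arith_tac.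
move=> e; rewrite -/(b e) -/(P e) -/(K e) => /= lt_B.
have iterE m x : iteri m (fun j a => F j a e) x = iter m (nstep (b e) (P e) (K e)) x.
  by elim: m => //= m ->.
rewrite GE => [|i le_i]; first by rewrite [iteri _ _ _]iterE.
by rewrite [iteri _ _ _]iterE; apply: lt_B.
Qed.

Lemma pack_small K w h q : q < K -> h < K ->
  [/\ pack K w h q %% K = q, pack K w h q %/ K %% K = h
    & pack K w h q %/ K %/ K = w].
Proof.
move=> lt_q lt_h; have K_gt0 : 0 < K by lia.
have E : pack K w h q %/ K = w * K + h by rewrite /pack divnMDl // divn_small ?addn0.
rewrite E divnMDl // (divn_small lt_h) addn0 modnMDl (modn_small lt_h).
by rewrite /pack modnMDl modn_small.
Qed.

(** * Numerical steps agree with the steps of the encoded machine *)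

Section ProgramCode.

Variables (M : machine) (c : nat) (l : seq (state M * letter M)).
Let ds := flatten [seq instruction_digits zg | zg <- l].
Let b := 2 ^ c.
Let P := of_digits b ds.
Hypothesis l_enum : perm_eq l (enum {: state M * letter M}).
Hypothesis ds_lt : all (fun d => d < 2 ^ c) ds.

Lemma size_instruction_digits (zg : state M * letter M) :
  size (instruction_digits zg) = 5.
Proof. by rewrite /instruction_digits; case: (delta _ _) => [[]]. Qed.

Lemma size_digits : size ds = 5 * size l.
Proof.
rewrite /ds; elim: (l) => [//|zg l' IHl] /=.
by rewrite size_cat size_instruction_digits IHl; lia.
Qed.

Lemma nth_digits zg0 j i : j < size l -> i < 5 ->
  nth 0 ds (5 * j + i) = nth 0 (instruction_digits (nth zg0 l j)) i.
Proof.
move=> lt_j lt_i; rewrite /ds; elim: (l) j lt_j => [//|zg l' IHl] [|j] lt_j /=.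
  by rewrite nth_cat size_instruction_digits lt_i.
rewrite nth_cat size_instruction_digits -IHl //.
have -> : 5 * j.+1 + i < 5 = false by lia.
by congr nth; lia.
Qed.

Lemma mem_l zg : zg \in l.
Proof. by rewrite (perm_mem l_enum) mem_enum. Qed.

Lemma digits_ltn k : nth 0 ds k < b.
Proof.
case: (ltnP k (size ds)) => [lt_k|le_k].
  by have /allP := ds_lt; apply; apply: mem_nth.
by rewrite nth_default // expn_gt0.
Qed.

Lemma instruction_digits_ltn (zg : state M * letter M) i : nth 0 (instruction_digits zg) i < b.
Proof.
case: (ltnP i 5) => [lt_i|le_i]; last first.
  by rewrite nth_default ?size_instruction_digits ?expn_gt0.
have /(nthP zg)[j lt_j <-] := mem_l zg.
by rewrite -nth_digits // digits_ltn.
Qed.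

Lemma state_digit_ltn (z : state M) : 2 ^ z < b.
Proof.
have := instruction_digits_ltn (z, blank M) 0.
by rewrite /instruction_digits; case: (delta _ _) => [[]].
Qed.

Lemma letter_digit_ltn (g : letter M) : 2 ^ g < b.
Proof.
have := instruction_digits_ltn (ord0, g) 1.
by rewrite /instruction_digits; case: (delta _ _) => [[]].
Qed.

Lemma base_gt1 : 1 < b. Proof. exact: state_digit_ltn ord0. Qed.

Lemma digit_program k : digit b P k = nth 0 ds k.
Proof.
case: (ltnP k (size ds)) => [lt_k|le_k].
  by apply: (digitE (d := nth 0 ds)) => // i _; apply: digits_ltn.
rewrite nth_default // /digit divn_small ?mod0n //.
apply: (@leq_trans (b ^ size ds)).
  by apply: (ltn_digits (d := nth 0 ds)) => i _; apply: digits_ltn.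
by rewrite leq_exp2l // base_gt1.
Qed.

(** This makes the range [j < P] in [lookup] reach every instruction. The state digit of the last
    instruction is nonzero and has weight [b ^ (5 * n) > 5 * n]. *)
Lemma size_leq_program : size l <= P.
Proof.
case def_n: (size l) => [//|n].
have lt_n : 5 * n < size ds by rewrite size_digits; lia.
rewrite /P /of_digits (bigD1 (Ordinal lt_n)) //=.
apply: leq_trans (leq_addr _ _).
have : 0 < nth 0 ds (5 * n).
  have -> : 5 * n = 5 * n + 0 by lia.
  rewrite (nth_digits (ord0, blank M)) ?def_n // /instruction_digits.
  by case: (delta _ _) => [[]] /= *; rewrite expn_gt0.
by have := ltn_expl (5 * n) base_gt1; nia.
Qed.

Lemma lookup_program (z : state M) (g : letter M) i :
  i < 5 ->
  lookup b P (2 ^ z) (2 ^ g) i = nth 0 (instruction_digits (z, g)) i.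
Proof.
move=> lt_i; have /(nthP (z, g))[j0 lt_j0 def_zg] := mem_l (z, g).
have uniq_l : uniq l by rewrite (perm_uniq l_enum) enum_uniq.
rewrite -def_zg -nth_digits // /lookup.
have lt_j0P : j0 < P := leq_trans lt_j0 size_leq_program.
rewrite -(sum_delta (fun j => nth 0 ds (5 * j + i)) lt_j0P).
apply: eq_bigr => j _; rewrite !digit_program; congr ((_ : bool) * _).
rewrite -[5 * j]addn0 -addnA add0n.
(* Beyond the program the digits are 0, whereas a state digit [2 ^ z] is positive: encoding by
   powers of 2 excludes spurious matches. *)
case: (ltnP j (size l)) => [lt_j|le_j]; last first.
  have -> : (j == j0 :> nat) = false.
    by apply/eqP => E; move: le_j; rewrite E leqNgt lt_j0.
  rewrite nth_default ?size_digits; last by lia.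
  by rewrite eq_sym -[_ == 0]negbK -lt0n expn_gt0.
rewrite !(nth_digits (z, g)) // -(nth_uniq (z, g) lt_j lt_j0 uniq_l) def_zg.
case: (nth (z, g) l j) => z1 g1; rewrite /instruction_digits.
case: (delta _ _) => [[z' g'] m] /=.
rewrite !eqn_exp2l // xpair_eqE; by [].
Qed.

Definition tape_num (L : nat) (tp : nat -> letter M) : nat :=
  \sum_(i < L) (2 ^ tp i - 1) * b ^ i.

Lemma letter_code_ltn (g : letter M) : 2 ^ g - 1 < b.
Proof. by have := letter_digit_ltn g; lia. Qed.

Lemma digit_tape L tp i : i < L -> digit b (tape_num L tp) i = 2 ^ tp i - 1.
Proof.
move=> lt_i; apply: (digitE (d := fun i => 2 ^ tp i - 1)) => // j _.
exact: letter_code_ltn.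
Qed.

Lemma tape_num_ltn L tp : tape_num L tp < b ^ L.
Proof.
by apply: (ltn_digits (d := fun i => 2 ^ tp i - 1)) => j _; apply: letter_code_ltn.
Qed.

Lemma tape_num_upd L tp h (g : letter M) : h < L ->
  tape_num L (fun i => if i == h then g else tp i)
  = tape_num L tp + (2 ^ g - 1) * b ^ h - (2 ^ tp h - 1) * b ^ h.
Proof.
move=> lt_h; rewrite /tape_num (bigD1 (Ordinal lt_h)) //= eqxx.
rewrite [X in _ = X + _ - _](bigD1 (Ordinal lt_h)) //=.
rewrite (eq_bigr (fun i : 'I_L => (2 ^ tp i - 1) * b ^ i)) => [|i].
  by rewrite -addnA addKn addnC.
by rewrite -val_eqE /= => /negbTE ->.
Qed.

Definition config_num (K L : nat) (k : config M) : nat :=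
  pack K (tape_num L (ctape k)) (chead k) (2 ^ cstate k).

Lemma nstep_config K L k k' :
  b < K -> chead k < K -> chead k < L -> step k = Some k' ->
  nstep b P K (config_num K L k) = config_num K L k'.
Proof.
move=> lt_bK lt_hK lt_hL; case: k lt_hK lt_hL => z tp h /= lt_hK lt_hL.
rewrite /step /=; case def_d: (delta z (tp h)) => [[z' g] m].
case def_m: (move_head m h) => [h'|//] [<-].
rewrite /nstep /config_num /=.
have [|-> -> ->] := @pack_small K (tape_num L tp) h (2 ^ z) _ lt_hK.
  exact: ltn_trans (state_digit_ltn z) lt_bK.
have u_eq : (2 ^ tp h - 1).+1 = 2 ^ tp h by rewrite subn1 prednK ?expn_gt0.
rewrite digit_tape // u_eq !lookup_program //.
rewrite /instruction_digits def_d /= tape_num_upd //.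
congr (pack _ _ _ _); move: def_m; rewrite /move_head.
case: m {def_d} => [[|[|[|m]]] lt_m] //=; last by case: (h) => // n [<-]; lia.
  by case=> <-; lia.
by case=> <-; lia.
Qed.

End ProgramCode.

(** * Support of a run, and its behaviour after halting *)

Section Runs.

Variables (M : machine) (s : nat) (a : s.-tuple nat).

Lemma runS t : run M a t.+1 = obind (@step M) (run M a t).
Proof. by []. Qed.

Lemma run_prefix t u k : u <= t -> run M a t = Some k -> exists k', run M a u = Some k'.
Proof.
move=> le_ut; rewrite -(subnK le_ut) /run iterD -/(run M a u).
case: (run M a u) => [k' _|]; first by exists k'.
suff -> : iter (t - u) (obind (@step M)) None = None by [].
by elim: (t - u) => //= n ->.
Qed.

Lemma size_input_word : size (input_word M a) = input_len a.
Proof.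
rewrite /input_word; elim: (tval a) => [//|x a' IHa] /=.
by rewrite size_cat IHa size_rcons size_nseq.
Qed.

Lemma run_support t k : run M a t = Some k ->
  chead k <= t /\ forall j, input_len a + t <= j -> ctape k j = blank M.
Proof.
elim: t k => [|t IHt] k.
  case=> <-; split=> // j; rewrite addn0 -size_input_word.
  exact: nth_default.
rewrite runS; case def_k1: (run M a t) => [k1|//] /=.
have [le_h blank1] := IHt _ def_k1; rewrite /step.
case: (delta _ _) => [[z' g] m].
case def_m: (move_head m (chead k1)) => [h'|//] [<-] /=; split=> [|j le_j].
  move: def_m; rewrite /move_head; case: (val m) => [[<-]|[[<-]|n]]; try lia.
  by case: (chead k1) le_h => // h le_h [<-]; lia.
case: eqP => [E|_]; last by apply: blank1; lia.
by move: le_j; rewrite E; lia.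
Qed.

Lemma halts_at_inj t k t' k' : halts_at a t k -> halts_at (M := M) a t' k' -> k = k'.
Proof.
move=> [run_t fin_t first_t] [run_t' fin_t' first_t'].
case: (ltngtP t t') => [lt_tt'|lt_t't|E]; last by move: run_t'; rewrite -E run_t => -[].
  by have := first_t' _ _ lt_tt' run_t; rewrite fin_t.
by have := first_t _ _ lt_t't run_t'; rewrite fin_t'.
Qed.

(** This allows the simulation to run up to any bound of the computation time. The tapes agree only
    pointwise, because each step rebuilds the tape function. *)
Lemma run_halted t k u : normed M -> halts_at a t k -> t <= u ->
  exists k', [/\ run M a u = Some k', chead k' = chead k & ctape k' =1 ctape k].
Proof.
move=> normM [run_t fin_k _] /subnK <-.
suff [k' [run_k' _ Hh Ht]] : exists k',
    [/\ run M a (u - t + t) = Some k', cstate k' = cstate k,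
        chead k' = chead k & ctape k' =1 ctape k] by exists k'.
elim: (u - t) => [|n [k' [run_k' Hs Hh Ht]]]; first by exists k.
rewrite addSn runS run_k' /= /step Hs normM //=.
eexists; split; first by []; rewrite //=.
by move=> i /=; case: eqP => [->|_]; rewrite Ht.
Qed.

End Runs.

Lemma tape_num_init M c s (a : s.-tuple nat) L :
  input_len a <= L ->
  tape_num c L (ctape (init M a)) = input_num (2 ^ c) a.
Proof.
rewrite /= /tape_of -(size_input_word M a) /input_word.
suff numE (w : seq (letter M)) L' : size w <= L' ->
    tape_num c L' (nth (blank M) w) = foldr (fun g r => 2 ^ val g - 1 + 2 ^ c * r) 0 w.
  move=> /numE->; elim: (tval a) => [//|x a' IHa].
  rewrite map_cons -cat1s flatten_cat foldr_cat IHa [flatten _]cats0 -cats1 foldr_cat /unary.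
  set r := input_num _ _; rewrite [foldr _ _ [:: _]]/= /ones.
  rewrite (_ : input_num _ _ = ones (2 ^ c) x.+1 + (2 ^ c) ^ x.+2 * r) //.
  elim: x.+1 => [|n IHn]; first by rewrite /ones big_ord0 /= expn1.
  rewrite [foldr _ _ _]/= IHn /ones big_ord_recl /=.
  rewrite mulnDr mulnA -expnS addnA; congr (_ + _ + _).
  by rewrite big_distrr /=; apply: eq_bigr => i _; rewrite -expnS.
elim: w L' => [|g w IHw] L' le_L.
  by apply: big1 => i _; rewrite nth_nil.
case: L' le_L => [//|L'] le_L; rewrite /tape_num.
rewrite (digits_recl L' (fun i => 2 ^ nth (blank M) (g :: w) i - 1)).
by rewrite -/(tape_num c L' (nth (blank M) w)) IHw //= mulnC addnC.
Qed.

Lemma tape_num_output M c L n (tp : nat -> letter M) :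
  (forall j, L <= j -> tp j = blank M) -> tp =1 tape_of (unary M n) ->
  tape_num c L tp = ones (2 ^ c) n.+1.
Proof.
move=> tp_blank tpE.
have tp_stroke i : tp i = if i < n.+1 then stroke M else blank M.
  by rewrite tpE /tape_of /unary nth_nseq.
have lt_nL : n.+1 <= L.
  by rewrite ltnNge; apply/negP => /tp_blank; rewrite tp_stroke ltnSn.
rewrite /ones (big_ord_widen L (fun i => (2 ^ c) ^ i) lt_nL) big_mkcond /=.
apply: eq_bigr => i _; rewrite tp_stroke; case: ifP => _ //.
by rewrite expn1 mul1n.
Qed.

Fixpoint term_of n (t : aterm) : term n :=
  match t with
  | AVar k => if insub k is Some i then Var i else Const n 0
  | ACst c => Const n c
  | AAdd u v => Add (term_of n u) (term_of n v)
  | ASub u v => Defs.Sub (term_of n u) (term_of n v)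
  | AMul u v => Mul (term_of n u) (term_of n v)
  | ADivS u v => Div (term_of n u) (Add (Const n 1) (term_of n v))
  | APow2 u => Exp (Const n 2) (term_of n u)
  end.

Lemma eval_term_of n t (x : n.-tuple nat) : eval (term_of n t) x = aeval t (nth 0 x).
Proof.
elim: t => //= [k|u -> v ->|u -> v ->|u -> v ->|u -> v ->|u ->] //.
case: insubP => [i _ <-|]; first exact: tnth_nth.
by rewrite -leqNgt => le_nk; rewrite nth_default ?size_tuple.
Qed.

Lemma universal_aterm s : exists u : aterm,
  forall (f : s.-tuple nat -> nat) (M : machine) (C : nat),
    normed M -> computes M f -> program_code M C ->
    forall (a : s.-tuple nat) (t T : nat),
      comp_time M a t -> t <= T ->
      aeval u (nth 0 (C :: rcons a T)) = f a.
Proof.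
have [U [u Uu] HU] := exists_upsilon s.
exists u => f M C normM compM [c [l [l_enum ds_lt ->]]] a t T [k halt_k] le_tT.
rewrite Uu; set e := nth 0 _.
have e0 : e 0 = cantor c (of_digits (2 ^ c) (flatten [seq instruction_digits zg | zg <- l])).
  by [].
have eT : e s.+1 = T by rewrite /e /= nth_rcons size_tuple ltnn eqxx.
have ea : [seq e j | j <- iota 1 s] = a.
  apply: (@eq_from_nth _ 0) => [|i]; rewrite size_map size_iota ?size_tuple // => lt_i.
  rewrite (nth_map 0) ?size_iota // nth_iota // /e /= nth_rcons size_tuple lt_i.
  by [].
have := HU e; rewrite e0 eT ea unpair1K unpair2K.
set b := 2 ^ c; set P := of_digits _ _; set K := b + T + 1.
set L := input_len a + T + 1 => /=; rewrite -/K => HUe.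
have [kT [run_T head_T tape_T]] := run_halted normM halt_k le_tT.
have iterE i ki : i <= T -> run M a i = Some ki ->
    iter i (nstep b P K) (pack K (input_num b a) 0 1) = config_num c K L ki.
  elim: i ki => [|i IHi] ki le_i.
    case=> <-; rewrite /config_num tape_num_init // /L; lia.
  rewrite runS; case run_i: (run M a i) => [k1|//] /= step_k.
  have [le_h _] := run_support run_i.
  by rewrite (IHi k1) ?(nstep_config l_enum ds_lt _ _ _ step_k) // /K /L; lia.
rewrite HUe => [|i le_i]; last first.
  have [ki run_i] := run_prefix le_i run_T.
  have [le_h _] := run_support run_i.
  rewrite (iterE _ ki) // /config_num /pack.
  have := tape_num_ltn l_enum ds_lt L (ctape ki).
  have := state_digit_ltn l_enum ds_lt (cstate ki).
  rewrite -/b; have : b <= K by rewrite /K; lia.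
  have : chead ki < K by rewrite /K; lia.
  by move: (tape_num _ _ _) (chead ki) (2 ^ _) (b ^ L) => w h q B; nia.
rewrite (iterE _ kT) //.
have [le_h blank_T] := run_support run_T.
have [||_ _ ->] := @pack_small K (tape_num c L (ctape kT)) (chead kT) (2 ^ cstate kT).
- by have := state_digit_ltn l_enum ds_lt (cstate kT); rewrite -/b /K; lia.
- by rewrite /K; lia.
have [t0 [k0 [halt_0 [_ out_0]]]] := compM a.
rewrite -(halts_at_inj halt_k halt_0) in out_0.
rewrite (@tape_num_output M c L (f a)) => [|j le_j|j].
- exact: output_val_ones (base_gt1 l_enum ds_lt).
- by apply: blank_T; rewrite /L in le_j; lia.
- by rewrite tape_T out_0.
Qed.

(** * Elementary functions *)

Lemma elementary_aterm n (f : n.-tuple nat -> nat) :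
  elementary f -> exists t, forall x : n.-tuple nat, aeval t (nth 0 x) = f x.
Proof.
have cons_env m (x : m.+1.-tuple nat) (i : nat) :
    scons i (fun k => nth 0 x k.+1) =1 nth 0 (i :: behead x).
  by case=> [|k] //=; rewrite nth_behead.
have theadE m (x : m.+1.-tuple nat) : nth 0 x 0 = thead x.
  by rewrite /thead (tnth_nth 0).
have arith_cons t : arith (fun e => aeval t (scons (e 0) (fun k => e k.+2))).
  exists (asubst (scons (AVar 0) (fun k => AVar k.+2)) t) => e.
  by rewrite aeval_subst; apply: eq_aeval => -[].
elim=> {n f}.
- by move=> n; exists (ACst 0).
- by exists (AAdd (ACst 1) (AVar 0)) => x; rewrite /= theadE.
- by move=> n i; exists (AVar i) => x; rewrite (tnth_nth 0).
- by exists (AAdd (AVar 0) (AVar 1)) => x; rewrite /= !(tnth_nth 0).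
- by exists (ASub (AVar 0) (AVar 1)) => x; rewrite /= !(tnth_nth 0).
- move=> m n g h _ [tg Hg] _ /fin_all_exists[th Hh].
  exists (asubst (fun k => if insub k is Some i then th i else ACst 0) tg) => x.
  rewrite aeval_subst -Hg; apply: eq_aeval => k.
  case: insubP => [i lt_k <-|]; first by rewrite Hh -tnth_nth tnth_mktuple.
  by rewrite -leqNgt => le_k; rewrite nth_default ?size_tuple.
- move=> n f _ [t Ht].
  have [u Hu] := arith_sum (F := fun i e => aeval t (scons i (fun k => e k.+1)))
    (arith_var 0) (arith_cons t).
  exists u => x; rewrite Hu theadE; apply: eq_bigr => i _.
  by rewrite -Ht; apply: eq_aeval; apply: cons_env.
- move=> n f _ [t Ht].
  have [u Hu] := arith_prod (F := fun i e => aeval t (scons i (fun k => e k.+1)))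
    (arith_var 0) (arith_cons t).
  exists u => x; rewrite Hu theadE; apply: eq_bigr => i _.
  by rewrite -Ht; apply: eq_aeval; apply: cons_env.
- by move=> n f g fg _ [t Ht]; exists t => x; rewrite Ht fg.
Qed.

Section ElementaryClosure.

Variables (n : nat) (f g : n.-tuple nat -> nat).
Hypotheses (Hf : elementary f) (Hg : elementary g).

Lemma elementary_comp2 (F : 2.-tuple nat -> nat) :
  elementary F -> elementary (fun x => F [tuple f x; g x]).
Proof.
move=> HF.
have Hh (i : 'I_2) : elementary (if i == ord0 then f else g) by case: eqP.
apply: elem_ext (elem_comp HF Hh) => x; congr F.
by apply: eq_from_tnth => -[[|[|i]] lt_i] //; rewrite tnth_mktuple.
Qed.

Lemma elementary_add : elementary (fun x => f x + g x).
Proof. exact: elem_ext (elementary_comp2 elem_add). Qed.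

Lemma elementary_sub : elementary (fun x => f x - g x).
Proof. exact: elem_ext (elementary_comp2 elem_sub). Qed.

Lemma elementary_succ : elementary (fun x => (f x).+1).
Proof.
apply: elem_ext (elem_comp elem_succ (h := fun=> f) (fun=> Hf)) => x.
by rewrite /thead tnth_mktuple.
Qed.

Lemma elementary_weaken : elementary (fun y : n.+1.-tuple nat => f [tuple of behead y]).
Proof.
apply: elem_ext (elem_comp Hf (fun i => elem_proj (lift ord0 i))) => y.
congr f; apply: eq_from_tnth => i.
by rewrite tnth_mktuple !(tnth_nth 0) nth_behead.
Qed.

Lemma elementary_cons (F : n.+1.-tuple nat -> nat) :
  elementary F -> elementary (fun x => F [tuple of f x :: x]).
Proof.
move=> HF; pose h (i : 'I_n.+1) x := if unlift ord0 i is Some j then tnth x j else f x.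
have Hh i : elementary (h i).
  by rewrite /h; case: (unlift ord0 i) => [j|] //; apply: elem_proj.
apply: elem_ext (elem_comp HF Hh) => x; congr F.
apply: eq_from_tnth => i; rewrite tnth_mktuple /h.
by case: unliftP => [j|] ->; rewrite !(tnth_nth 0).
Qed.

End ElementaryClosure.

Lemma elementary_const n c : elementary (fun _ : n.-tuple nat => c).
Proof. by elim: c => [|c IHc]; [apply: elem_zero | apply: elementary_succ]. Qed.

Lemma elementary_sum n (f : n.-tuple nat -> nat) (F : n.+1.-tuple nat -> nat) :
  elementary f -> elementary F ->
  elementary (fun x => \sum_(i < f x) F [tuple of val i :: x]).
Proof.
move=> Hf HF; apply: elem_ext (elementary_cons Hf (elem_sum HF)) => x.
rewrite theadE; apply: eq_bigr => i _; congr F.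
by apply: val_inj; rewrite /= .
Qed.

Lemma elementary_prod n (f : n.-tuple nat -> nat) (F : n.+1.-tuple nat -> nat) :
  elementary f -> elementary F ->
  elementary (fun x => \prod_(i < f x) F [tuple of val i :: x]).
Proof.
move=> Hf HF; apply: elem_ext (elementary_cons Hf (elem_prod HF)) => x.
rewrite theadE; apply: eq_bigr => i _; congr F.
by apply: val_inj; rewrite /= .
Qed.

Lemma elementary_mul n (f g : n.-tuple nat -> nat) :
  elementary f -> elementary g -> elementary (fun x => f x * g x).
Proof.
move=> Hf Hg; apply: elem_ext (elementary_sum Hf (elementary_weaken Hg)) => x.
rewrite (eq_bigr (fun=> g x)) => [|i _]; last by congr g; apply: val_inj.
by rewrite sum_nat_const card_ord.
Qed.

(** [1 - (z - x)] is the indicator of [z <= x], so the sum counts the positive multiples of [y.+1]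
    up to [x]. *)
Lemma divn_sum x y : x %/ y.+1 = \sum_(i < x) (1 - (i.+1 * y.+1 - x)).
Proof.
have le_x : x %/ y.+1 <= x by apply: leq_div.
rewrite -[LHS]muln1 -[_ %/ _ in LHS]card_ord -sum_nat_const.
rewrite (big_ord_widen x (fun=> 1) le_x) big_mkcond; apply: eq_bigr => i _ /=.
rewrite (leq_divRL _ _ (ltn0Sn y)).
by move: (i.+1 * y.+1) => z; case: leqP; lia.
Qed.

Lemma elementary_aeval n t : elementary (fun x : n.-tuple nat => aeval t (nth 0 x)).
Proof.
elim: t => /= [k|c|t Ht u Hu|t Ht u Hu|t Ht u Hu|t Ht u Hu|t Ht].
- case: (ltnP k n) => [lt_kn|le_nk].
    by apply: elem_ext (elem_proj (Ordinal lt_kn)) => x; rewrite (tnth_nth 0).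
  by apply: elem_ext (elem_zero n) => x; rewrite nth_default ?size_tuple.
- exact: elementary_const.
- exact: elementary_add.
- exact: elementary_sub.
- exact: elementary_mul.
- set f := fun x : n.-tuple nat => aeval t (nth 0 x) in Ht.
  set g := fun x : n.-tuple nat => aeval u (nth 0 x) in Hu.
  apply: elem_ext (elementary_sum Ht (elementary_sub (elementary_const _ 1)
    (elementary_sub (elementary_mul (elementary_succ (elem_proj ord0))
      (elementary_succ (elementary_weaken Hu))) (elementary_weaken Ht)))) => x.
  rewrite /= divn_sum; apply: eq_bigr => i _.
  by rewrite (tnth_nth 0) /f /g.
- apply: elem_ext (elementary_prod Ht (elementary_const _ 2)) => x.
  by rewrite prod_nat_const card_ord.
Qed.

(** * Register programs *)

(* [CWhile r c] loops while register [r] is nonzero, and [CRead r c] while the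
   input has a stroke at the position contained in [r]. *)
Inductive cmd : Type :=
| CSkip
| CInc of nat
| CDec of nat
| CSeq of cmd & cmd
| CWhile of nat & cmd
| CRead of nat & cmd.

Definition upd (s : nat -> nat) (r x : nat) : nat -> nat :=
  fun k => if k == r then x else s k.

(* [exec inp c s s' n]: from the registers [s], the command [c] ends with the
   registers [s'] after at most [n] elementary instructions. *)
Inductive exec (inp : nat -> bool) : cmd -> (nat -> nat) -> (nat -> nat) -> nat -> Prop :=
| exec_skip s s' n : s' =1 s -> exec inp CSkip s s' n
| exec_inc r s s' n : 0 < n -> s' =1 upd s r (s r).+1 -> exec inp (CInc r) s s' n
| exec_dec r s s' n : 0 < n -> s' =1 upd s r (s r).-1 -> exec inp (CDec r) s s' n
| exec_seq c d s1 s2 s3 n1 n2 n :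
    exec inp c s1 s2 n1 -> exec inp d s2 s3 n2 -> n1 + n2 <= n ->
    exec inp (CSeq c d) s1 s3 n
| exec_while0 r c s s' n :
    0 < n -> s r = 0 -> s' =1 s -> exec inp (CWhile r c) s s' n
| exec_whileS r c s1 s2 s3 n1 n2 n :
    s1 r != 0 -> exec inp c s1 s2 n1 -> exec inp (CWhile r c) s2 s3 n2 ->
    n1 + n2 + 2 <= n -> exec inp (CWhile r c) s1 s3 n
| exec_read0 r c s s' n :
    0 < n -> ~~ inp (s r) -> s' =1 s -> exec inp (CRead r c) s s' n
| exec_readS r c s1 s2 s3 n1 n2 n :
    inp (s1 r) -> exec inp c s1 s2 n1 -> exec inp (CRead r c) s2 s3 n2 ->
    n1 + n2 + 2 <= n -> exec inp (CRead r c) s1 s3 n.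

Section Programs.

Variable inp : nat -> bool.
Local Notation exec := (exec inp).

Lemma exec_ext c s s' n s'' m :
  exec c s s' n -> s'' =1 s' -> n <= m -> exec c s s'' m.
Proof.
move=> H; elim: H s'' m => {c s s' n}.
- by move=> s s' n E s'' m E' _; apply: exec_skip => k; rewrite E'.
- move=> r s s' n n_gt0 E s'' m E' le_nm; apply: exec_inc => [|k]; last by rewrite E'.
  exact: leq_trans le_nm.
- move=> r s s' n n_gt0 E s'' m E' le_nm; apply: exec_dec => [|k]; last by rewrite E'.
  exact: leq_trans le_nm.
- move=> c d s1 s2 s3 n1 n2 n H1 _ _ IH2 le_n s'' m E' le_nm.
  by apply: exec_seq H1 (IH2 _ _ E' (leqnn _)) _; lia.
- move=> r c s s' n n_gt0 s_r E s'' m E' le_nm; apply: exec_while0 => // [|k].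
    exact: leq_trans le_nm.
  by rewrite E'.
- move=> r c s1 s2 s3 n1 n2 n s_r H1 _ _ IH2 le_n s'' m E' le_nm.
  by apply: exec_whileS s_r H1 (IH2 _ _ E' (leqnn _)) _; lia.
- move=> r c s s' n n_gt0 s_r E s'' m E' le_nm; apply: exec_read0 => // [|k].
    exact: leq_trans le_nm.
  by rewrite E'.
- move=> r c s1 s2 s3 n1 n2 n s_r H1 _ _ IH2 le_n s'' m E' le_nm.
  by apply: exec_readS s_r H1 (IH2 _ _ E' (leqnn _)) _; lia.
Qed.

Lemma exec_extl c s s' n t : exec c s s' n -> t =1 s -> exec c t s' n.
Proof.
move=> H; elim: H t => {c s s' n}.
- by move=> s s' n E t Et; apply: exec_skip => k; rewrite E Et.
- move=> r s s' n n_gt0 E t Et; apply: exec_inc => // k.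
  by rewrite E /upd !Et.
- move=> r s s' n n_gt0 E t Et; apply: exec_dec => // k.
  by rewrite E /upd !Et.
- move=> c d s1 s2 s3 n1 n2 n _ IH1 H2 _ le_n t Et.
  exact: exec_seq (IH1 _ Et) H2 le_n.
- move=> r c s s' n n_gt0 s_r E t Et; apply: exec_while0 => // [|k]; by rewrite ?Et ?E.
- move=> r c s1 s2 s3 n1 n2 n s_r _ IH1 H2 _ le_n t Et.
  by apply: exec_whileS (IH1 _ Et) H2 le_n; rewrite Et.
- move=> r c s s' n n_gt0 s_r E t Et; apply: exec_read0 => // [|k]; by rewrite ?Et ?E.
- move=> r c s1 s2 s3 n1 n2 n s_r _ IH1 H2 _ le_n t Et.
  by apply: exec_readS (IH1 _ Et) H2 le_n; rewrite Et.
Qed.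

(* [S m] are the registers when [m] more rounds are to be made. *)
Lemma exec_while r c (S : nat -> nat -> nat) N K :
  S 0 r = 0 -> (forall m, m < N -> S m.+1 r != 0) ->
  (forall m, m < N -> exec c (S m.+1) (S m) K) ->
  exec (CWhile r c) (S N) (S 0) (N * (K + 2) + 1).
Proof.
move=> S0; elim: N => [|N IHN] SS HS; first by apply: exec_while0; rewrite ?S0.
apply: exec_whileS (SS N _) (HS N _) (IHN _ _) _ => //.
- by move=> m lt_m; apply: SS; lia.
- by move=> m lt_m; apply: HS; lia.
- by lia.
Qed.

Lemma exec_read r c (S : nat -> nat -> nat) N K :
  ~~ inp (S 0 r) -> (forall m, m < N -> inp (S m.+1 r)) ->
  (forall m, m < N -> exec c (S m.+1) (S m) K) ->
  exec (CRead r c) (S N) (S 0) (N * (K + 2) + 1).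
Proof.
move=> S0; elim: N => [|N IHN] SS HS; first by apply: exec_read0.
apply: exec_readS (SS N _) (HS N _) (IHN _ _) _ => //.
- by move=> m lt_m; apply: SS; lia.
- by move=> m lt_m; apply: HS; lia.
- by lia.
Qed.

Definition CFor (r : nat) (c : cmd) : cmd := CWhile r (CSeq (CDec r) c).

Lemma exec_for r c (S : nat -> nat -> nat) N K s s' n :
  s =1 S N -> s' =1 S 0 ->
  (forall m, m <= N -> S m r = m) ->
  (forall m, m < N -> exec c (upd (S m.+1) r m) (S m) K) ->
  N * (K + 3) + 1 <= n ->
  exec (CFor r c) s s' n.
Proof.
move=> sE s'E Sr HS le_n.
have H : exec (CFor r c) (S N) (S 0) (N * (K.+1 + 2) + 1).
  apply: exec_while => [|m lt_m|m lt_m]; [exact: Sr|by rewrite Sr|].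
  apply: (exec_seq (n1 := 1)) (HS m lt_m) (leqnn _).
  by apply: exec_dec; rewrite // Sr.
by apply: exec_ext (exec_extl H sE) s'E _; lia.
Qed.

Ltac regs := rewrite /eqfun /upd /=; intros; repeat case: eqP => ?; subst; try lia.

Lemma exec_seqD c d s1 s2 s3 n1 n2 :
  exec c s1 s2 n1 -> exec d s2 s3 n2 -> exec (CSeq c d) s1 s3 (n1 + n2).
Proof. by move=> H1 H2; apply: exec_seq H1 H2 (leqnn _). Qed.

Lemma exec_inc1 r s : exec (CInc r) s (upd s r (s r).+1) 1.
Proof. exact: exec_inc. Qed.

Lemma exec_dec1 r s : exec (CDec r) s (upd s r (s r).-1) 1.
Proof. exact: exec_dec. Qed.

(* [t] is a scratch register, which is restored to [0]. *)
Definition add_to i j t := CSeq (CFor i (CSeq (CInc j) (CInc t))) (CFor t (CInc i)).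
Definition sub_from i j t := CSeq (CFor i (CSeq (CDec j) (CInc t))) (CFor t (CInc i)).

Lemma exec_add_to (i j t : nat) s :
  i != j -> i != t -> j != t -> s t = 0 ->
  exec (add_to i j t) s (upd s j (s j + s i)) (9 * s i + 2).
Proof.
move=> ij it jt t0; set a := s i; set b := s j.
have -> : 9 * a + 2 = (a * (2 + 3) + 1) + (a * (1 + 3) + 1) by lia.
apply: (@exec_seqD _ _ _ (upd (upd (upd s i 0) j (b + a)) t a)).
  apply: (@exec_for _ _ (fun m => upd (upd (upd s i m) j (b + (a - m))) t (a - m)) a 2) => //.
  - by regs.
  - by regs.
  - by regs.
  move=> m lt_m; apply: exec_ext (exec_seqD (exec_inc1 _ _) (exec_inc1 _ _)) _ (leqnn _).
  by regs.
apply: (@exec_for _ _ (fun m => upd (upd (upd s i (a - m)) j (b + a)) t m) a 1) => //.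
- by regs.
- by regs.
- by regs.
by move=> m lt_m; apply: exec_ext (exec_inc1 _ _) _ (leqnn _); regs.
Qed.

Lemma exec_sub_from (i j t : nat) s :
  i != j -> i != t -> j != t -> s t = 0 ->
  exec (sub_from i j t) s (upd s j (s j - s i)) (9 * s i + 2).
Proof.
move=> ij it jt t0; set a := s i; set b := s j.
have -> : 9 * a + 2 = (a * (2 + 3) + 1) + (a * (1 + 3) + 1) by lia.
apply: (@exec_seqD _ _ _ (upd (upd (upd s i 0) j (b - a)) t a)).
  apply: (@exec_for _ _ (fun m => upd (upd (upd s i m) j (b - (a - m))) t (a - m)) a 2) => //.
  - by regs.
  - by regs.
  - by regs.
  move=> m lt_m; apply: exec_ext (exec_seqD (exec_dec1 _ _) (exec_inc1 _ _)) _ (leqnn _).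
  by regs.
apply: (@exec_for _ _ (fun m => upd (upd (upd s i (a - m)) j (b - a)) t m) a 1) => //.
- by regs.
- by regs.
- by regs.
by move=> m lt_m; apply: exec_ext (exec_inc1 _ _) _ (leqnn _); regs.
Qed.

Definition mul_code d :=
  CSeq (CFor d (add_to d.+1 d.+2 d.+3))
       (CSeq (CFor d.+1 CSkip) (CFor d.+2 (CInc d))).

(** After [j] rounds register [d] contains [a - j * b.+1 - b], which is nonzero exactly when [b.+1]
    fits once more into [a]; a round takes off 1 and then [b]. *)
Definition divS_code d :=
  CSeq (sub_from d.+1 d d.+3)
    (CSeq (CWhile d (CSeq (CInc d.+2) (CSeq (CDec d) (sub_from d.+1 d d.+3))))
       (CSeq (CFor d.+1 CSkip) (CFor d.+2 (CInc d)))).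

Definition pow2_code d :=
  CSeq (CInc d.+1)
    (CSeq (CFor d (CSeq (CFor d.+1 (CSeq (CInc d.+2) (CInc d.+2)))
                        (CFor d.+2 (CInc d.+1))))
          (CFor d.+1 (CInc d))).

Section StackCode.

Variables (d : nat) (r : nat -> nat).
Hypothesis r0 : forall k, d <= k -> r k = 0.

Lemma exec_clear a b v :
  exec (CFor d.+1 CSkip) (upd (upd (upd r d a) d.+1 b) d.+2 v)
    (upd (upd r d a) d.+2 v) (3 * b + 1).
Proof.
apply: (@exec_for _ _ (fun m => upd (upd (upd r d a) d.+1 m) d.+2 v) b 0); try by [regs | lia].
- by regs; rewrite r0; lia.
- by move=> m _; apply: exec_skip; regs.
Qed.

Lemma exec_move v :
  exec (CFor d.+2 (CInc d)) (upd (upd r d 0) d.+2 v) (upd r d v) (4 * v + 1).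
Proof.
apply: (@exec_for _ _ (fun m => upd (upd r d (v - m)) d.+2 m) v 1); try by [regs | lia].
- by regs; rewrite r0; lia.
- by move=> m lt_m; apply: exec_ext (exec_inc1 _ _) _ (leqnn _); regs.
Qed.

Lemma exec_mul a b :
  exec (mul_code d) (upd (upd r d a) d.+1 b) (upd r d (a * b))
    (a * (9 * b + 5) + 4 * (a * b) + 3 * b + 3).
Proof.
apply: (exec_seq (n1 := a * (9 * b + 5) + 1))
  (exec_seqD (exec_clear 0 b (a * b)) (exec_move (a * b))) _; last by lia.
  apply: (@exec_for _ _ (fun m => upd (upd (upd r d m) d.+1 b) d.+2 ((a - m) * b)) a
    (9 * b + 2)); try by [regs | lia].
  - by regs; rewrite r0; lia.
  move=> m lt_m; apply: exec_ext (exec_add_to _ _ _ _) _ _; try by [regs | lia].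
  - by rewrite /upd; regs; rewrite r0; lia.
  - by regs; nia.
Qed.

Lemma divS_sub a b q m :
  q = a %/ b.+1 -> m < q ->
  (a - (q - m.+1) * b.+1 - b).-1 - b = a - (q - m) * b.+1 - b.
Proof.
move=> q_eq lt_m; have -> : q - m.+1 = (q - m) - 1 by lia.
have : 0 < q - m by lia.
move: (q - m) => n n_gt0; case: n n_gt0 => // n _; rewrite subn1 /=.
by move: (n * b.+1) (mulSn n b.+1) => z ->; lia.
Qed.

Lemma divS_neq0 a b q m :
  q = a %/ b.+1 -> m < q -> a - (q - m.+1) * b.+1 - b != 0.
Proof.
move=> q_eq lt_m; have le_a : q * b.+1 <= a by rewrite q_eq leq_trunc_div.
have : (q - m.+1).+1 * b.+1 <= a.
  by apply: leq_trans le_a; apply: leq_mul => //; lia.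
by rewrite mulSn; move: ((q - m.+1) * b.+1) => z; lia.
Qed.

Lemma exec_divS a b :
  exec (divS_code d) (upd (upd r d a) d.+1 b) (upd r d (a %/ b.+1))
    (a * (9 * b + 6) + 4 * a + 12 * b + 5).
Proof.
set q := a %/ b.+1; have le_q : q <= a := leq_div _ _.
pose S m := upd (upd (upd r d (a - (q - m) * b.+1 - b)) d.+1 b) d.+2 (q - m).
have S0 : S 0 =1 upd (upd (upd r d 0) d.+1 b) d.+2 q.
  rewrite /S subn0 (_ : a - q * b.+1 - b = 0) //.
  by have := divn_eq a b.+1; have := ltn_pmod a (ltn0Sn b); rewrite -/q; lia.
have H : exec (CWhile d (CSeq (CInc d.+2) (CSeq (CDec d) (sub_from d.+1 d d.+3))))
    (S q) (S 0) (q * ((9 * b + 4) + 2) + 1).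
  apply: exec_while => [|m lt_m|m lt_m].
  - by rewrite S0; regs.
  - have := divS_neq0 (erefl q) lt_m.
    by rewrite /S /upd /= eqxx; do 2 (case: (eqVneq d _) => [?|_]; first by lia).
  pose S1 := upd (S m.+1) d.+2 (q - m).
  pose S2 := upd S1 d (a - (q - m.+1) * b.+1 - b).-1.
  apply: (exec_seq (s2 := S1) (n1 := 1) (n2 := 9 * b + 3)); last by lia.
    by apply: exec_ext (exec_inc1 _ _) _ (leqnn _); rewrite /S1 /S; regs.
  apply: (exec_seq (s2 := S2) (n1 := 1) (n2 := 9 * b + 2)); last by lia.
    by apply: exec_ext (exec_dec1 _ _) _ (leqnn _); rewrite /S2 /S1 /S; regs.
  apply: exec_ext (exec_sub_from _ _ _ _) _ _; try by lia.
  - by rewrite /S2 /S1 /S; regs; rewrite r0; lia.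
  - have E := divS_sub (erefl q) lt_m.
    by rewrite /S2 /S1 /S; regs.
  - by rewrite /S2 /S1 /S; regs.
have H2 := exec_seqD H (exec_extl (exec_seqD (exec_clear 0 b q) (exec_move q)) S0).
apply: exec_seq (exec_ext (exec_sub_from _ _ _ _) (s'' := S q) _ (leqnn _)) H2 _; try by lia.
- by regs; rewrite r0; lia.
- by rewrite /S; regs; rewrite r0; lia.
by rewrite /upd /= eqxx; nia.
Qed.

Lemma exec_pow2 a :
  exec (pow2_code d) (upd r d a) (upd r d (2 ^ a)) (a * (13 * 2 ^ a + 5) + 4 * 2 ^ a + 3).
Proof.
have H : exec (CFor d (CSeq (CFor d.+1 (CSeq (CInc d.+2) (CInc d.+2)))
                        (CFor d.+2 (CInc d.+1))))
    (upd (upd r d a) d.+1 1) (upd (upd r d 0) d.+1 (2 ^ a))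
    (a * (13 * 2 ^ a + 2 + 3) + 1).
  apply: (@exec_for _ _ (fun m => upd (upd r d m) d.+1 (2 ^ (a - m))) a (13 * 2 ^ a + 2));
    try by [regs | lia].
  - by regs; rewrite ?subnn // ?subn0.
  - by regs; rewrite ?subn0.
  move=> m lt_m; set p := 2 ^ (a - m.+1).
  have p_eq : 2 ^ (a - m) = 2 * p by rewrite -expnS; congr expn; lia.
  have le_p : p <= 2 ^ a by rewrite leq_exp2l //; lia.
  rewrite p_eq; apply: (exec_seq (s2 := upd (upd r d m) d.+2 (2 * p))
    (n1 := p * (2 + 3) + 1) (n2 := (2 * p) * (1 + 3) + 1)); last by lia.
    apply: (@exec_for _ _ (fun k => upd (upd (upd r d m) d.+1 k) d.+2 (2 * (p - k))) p 2);
      try by [regs | lia].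
    - by regs; rewrite r0; lia.
    - by regs; rewrite r0; lia.
    move=> k lt_k; apply: exec_ext (exec_seqD (exec_inc1 _ _) (exec_inc1 _ _)) _ (leqnn _).
    by regs.
  apply: (@exec_for _ _ (fun k => upd (upd (upd r d m) d.+1 (2 * p - k)) d.+2 k) (2 * p) 1);
    try by [regs | lia].
  - by regs; rewrite r0; lia.
  - by regs; rewrite r0; lia.
  by move=> k lt_k; apply: exec_ext (exec_inc1 _ _) _ (leqnn _); regs.
apply: exec_seq (exec_ext (exec_inc1 _ _) (s'' := upd (upd r d a) d.+1 1) _ (leqnn _))
  (exec_seqD (n2 := 2 ^ a * 4 + 1) H _) _.
- by regs; rewrite r0; lia.
- apply: (@exec_for _ _ (fun k => upd (upd r d (2 ^ a - k)) d.+1 k) (2 ^ a) 1);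
    try by [regs | lia].
  - by regs; rewrite ?r0; lia.
  by move=> k lt_k; apply: exec_ext (exec_inc1 _ _) _ (leqnn _); regs.
by lia.
Qed.

End StackCode.

(* Stack code: the value of [t] is put in register [d], the registers from [d] on
   being null, and the variables in the registers below [n]. *)
Fixpoint stack_code (n : nat) (t : aterm) (d : nat) : cmd :=
  match t with
  | AVar k => if k < n then add_to k d d.+1 else CSkip
  | ACst c => iter c (CSeq (CInc d)) CSkip
  | AAdd t u => CSeq (stack_code n t d) (CSeq (stack_code n u d.+1) (CFor d.+1 (CInc d)))
  | ASub t u => CSeq (stack_code n t d) (CSeq (stack_code n u d.+1) (CFor d.+1 (CDec d)))
  | AMul t u => CSeq (stack_code n t d) (CSeq (stack_code n u d.+1) (mul_code d))
  | ADivS t u => CSeq (stack_code n t d) (CSeq (stack_code n u d.+1) (divS_code d))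
  | APow2 t => CSeq (stack_code n t d) (pow2_code d)
  end.

(** The cost is itself a term, so that the running time is elementary by [elementary_aeval]. The
    factor 20 dominates the constants of all the operator codes. *)
Fixpoint stack_cost (t : aterm) : aterm :=
  let cost2 t u := AAdd (AAdd (stack_cost t) (stack_cost u))
    (AMul (ACst 20) (AMul (AAdd t (ACst 1)) (AAdd u (ACst 1)))) in
  match t with
  | AVar k => AAdd (AMul (ACst 9) (AVar k)) (ACst 2)
  | ACst c => ACst c
  | AAdd t u => cost2 t u
  | ASub t u => cost2 t u
  | AMul t u => cost2 t u
  | ADivS t u => cost2 t u
  | APow2 t => AAdd (stack_cost t)
      (AMul (ACst 20) (AMul (AAdd t (ACst 1)) (APow2 t)))
  end.

Lemma exec_stack_code n t d r (e : nat -> nat) :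
  n <= d -> (forall k, d <= k -> r k = 0) ->
  (forall k, e k = if k < n then r k else 0) ->
  exec (stack_code n t d) r (upd r d (aeval t e)) (aeval (stack_cost t) e).
Proof.
move=> le_nd r0 re.
have bin op t1 u d' r' v K :
    n <= d' -> (forall k, d' <= k -> r' k = 0) ->
    (forall k, e k = if k < n then r' k else 0) ->
    (forall d r, n <= d -> (forall k, d <= k -> r k = 0) ->
      (forall k, e k = if k < n then r k else 0) ->
      exec (stack_code n t1 d) r (upd r d (aeval t1 e)) (aeval (stack_cost t1) e)) ->
    (forall d r, n <= d -> (forall k, d <= k -> r k = 0) ->
      (forall k, e k = if k < n then r k else 0) ->
      exec (stack_code n u d) r (upd r d (aeval u e)) (aeval (stack_cost u) e)) ->
    exec op (upd (upd r' d' (aeval t1 e)) d'.+1 (aeval u e)) (upd r' d' v) K ->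
    K <= 20 * ((aeval t1 e + 1) * (aeval u e + 1)) ->
    exec (CSeq (stack_code n t1 d') (CSeq (stack_code n u d'.+1) op)) r' (upd r' d' v)
      (aeval (stack_cost t1) e + aeval (stack_cost u) e
        + 20 * ((aeval t1 e + 1) * (aeval u e + 1))).
  move=> le_nd' r0' re' Ht Hu Hop le_K.
  apply: exec_seq (Ht _ _ le_nd' r0' re') (exec_seqD (Hu d'.+1 _ _ _ _) Hop) _; try by lia.
  - by move=> k le_k; rewrite /upd; case: eqP => [|_]; [lia | apply: r0'; lia].
  - by move=> k; rewrite re' /upd; case: ltnP => // lt_k; case: eqP => //; lia.
elim: t d r le_nd r0 re => [k|c|t Ht u Hu|t Ht u Hu|t Ht u Hu|t Ht u Hu|t Ht] d r le_nd r0 re.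
- rewrite /= re; case: ltnP => lt_k.
    have E : upd r d (r k) =1 upd r d (r d + r k) by rewrite (r0 d).
    by apply: exec_ext (exec_add_to _ _ _ _) E _; try lia; apply: r0.
  by apply: exec_skip; regs; rewrite r0.
- rewrite /=; have E : upd r d c =1 upd r d (r d + c) by rewrite (r0 d).
  apply: exec_ext (_ : exec _ _ (upd r d (r d + c)) c) E (leqnn _).
  elim: c (r) {r0 re} => [|c IHc] r'; first by apply: exec_skip; regs.
  apply: (exec_seq (n1 := 1)) (exec_inc1 _ _) (exec_ext (IHc _) _ (leqnn _)) _ => //.
  by regs.
- set a := aeval t e; set b := aeval u e.
  apply: (bin _ t u d r (a + b) (b * (1 + 3) + 1)) => //; last by rewrite -/a -/b; nia.
  apply: (@exec_for _ _ (fun m => upd (upd r d (a + b - m)) d.+1 m) b 1);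
    try by [regs | lia].
  - by regs; rewrite ?r0; lia.
  by move=> m lt_m; apply: exec_ext (exec_inc1 _ _) _ (leqnn _); regs.
- set a := aeval t e; set b := aeval u e.
  apply: (bin _ t u d r (a - b) (b * (1 + 3) + 1)) => //; last by rewrite -/a -/b; nia.
  apply: (@exec_for _ _ (fun m => upd (upd r d (a - (b - m))) d.+1 m) b 1);
    try by [regs | lia].
  - by regs; rewrite ?r0; lia.
  by move=> m lt_m; apply: exec_ext (exec_dec1 _ _) _ (leqnn _); regs.
- by apply: bin (exec_mul r0 _ _) _ => //; nia.
- by apply: bin (exec_divS r0 _ _) _ => //; nia.
- apply: exec_seq (Ht _ _ le_nd r0 re) (exec_pow2 r0 _) _ => /=.
  by have := expn_gt0 2 (aeval t e); nia.
Qed.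

(* Reads [m] arguments into the registers from [k] on; [p] points into the input. *)
Fixpoint load (p k m : nat) : cmd :=
  if m is m'.+1 then
    CSeq (CRead p (CSeq (CInc k) (CInc p)))
      (CSeq (CSeq (CDec k) (CInc p)) (load p k.+1 m'))
  else CSkip.

Fixpoint strokes (a : seq nat) : seq bool :=
  if a is x :: a' then nseq x.+1 true ++ false :: strokes a' else [::].

Definition load_cost (a : seq nat) : nat := foldr (fun x c => 4 * x + 7 + c) 0 a.

Lemma exec_load a p k o r :
  r p = o -> (forall i, inp (o + i) = nth false (strokes a) i) ->
  k + size a <= p -> (forall j, k <= j < k + size a -> r j = 0) ->
  exec (load p k (size a)) r
    (fun j => if j == p then o + size (strokes a)
              else if k <= j < k + size a then nth 0 a (j - k) else r j)
    (load_cost a).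
Proof.
elim: a k o r => [|x a IHa] k o r rp Hinp le_p r0 /=.
  by apply: exec_skip => j; case: eqP => [->|_]; [rewrite rp addn0 | case: ifP => //; lia].
pose r1 := upd (upd r k x.+1) p (o + x.+1).
pose r2 := upd (upd r k x) p (o + x.+2).
have le_p' : k + (size a).+1 <= p by [].
have H1 : exec (CRead p (CSeq (CInc k) (CInc p))) r r1 (x.+1 * 4 + 1).
  have := @exec_read p (CSeq (CInc k) (CInc p))
    (fun m => upd (upd r k (x.+1 - m)) p (o + (x.+1 - m))) x.+1 2.
  move=> H; apply: exec_extl (exec_ext (H _ _ _) _ (leqnn _)) _.
  - by rewrite /upd eqxx subn0 Hinp /= nth_cat size_nseq ltnn subnn.
  - move=> m lt_m; rewrite /upd eqxx Hinp.
    rewrite (_ : strokes _ = nseq x.+1 true ++ false :: strokes a) // nth_cat size_nseq.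
    have -> : x.+1 - m.+1 < x.+1 by lia.
    by rewrite nth_nseq; case: ifP => //; lia.
  - move=> m lt_m; apply: exec_ext (exec_seqD (exec_inc1 _ _) (exec_inc1 _ _)) _ (leqnn _).
    by regs.
  - by rewrite /r1; regs.
  - by regs; rewrite r0 //=; lia.
(* A number [x] is written with [x.+1] strokes: one is taken off, and the pointer skips the blank
   that follows. *)
have H2 : exec (CSeq (CDec k) (CInc p)) r1 r2 2.
  apply: exec_ext (exec_seqD (exec_dec1 _ _) (exec_inc1 _ _)) _ (leqnn _).
  by rewrite /r1 /r2; regs.
have H3 := IHa k.+1 (o + x.+2) r2.
apply: exec_ext (exec_seqD H1 (exec_seqD H2 (H3 _ _ _ _))) _ _.
- by rewrite /r2 /upd eqxx.
- move=> i; rewrite -addnA Hinp (_ : strokes _ = nseq x.+1 true ++ false :: strokes a) //.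
  rewrite nth_cat size_nseq; have -> : x.+2 + i < x.+1 = false by lia.
  by have -> : x.+2 + i - x.+1 = i.+1 by lia.
- by lia.
- move=> j lt_j; rewrite /r2 /upd; repeat case: eqP => ?; subst; try lia.
  by apply: r0; rewrite /=; lia.
- move=> j /=; case: (eqVneq j p) => [_|ne_p].
    by rewrite size_cat size_nseq /=; lia.
  rewrite /r2 /upd (negbTE ne_p).
  case: (eqVneq j k) => [->|ne_k].
    rewrite ltnn subnn leqnn; have -> : k < k + (size a).+1 by lia.
    by [].
  have -> : (k < j < k.+1 + size a) = (k <= j < k + (size a).+1) by lia.
  case: ifP => // lt_j; have -> : j - k = (j - k.+1).+1 by lia.
  by [].
by lia.
Qed.

(** The last increment is due to the output convention of [n.+1] strokes for [n]. Register [n] is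
    left at the end of the input, which guarantees that the final erasure goes over the whole
    input. *)
Definition program (n : nat) (t : aterm) : cmd :=
  CSeq (load n 0 n) (CSeq (stack_code n t n.+1) (CInc n.+1)).

Lemma exec_program n t (a : n.-tuple nat) :
  inp =1 nth false (strokes a) ->
  exists2 r, exec (program n t) (fun=> 0) r
    (load_cost a + (aeval (stack_cost t) (nth 0 a) + 1))
  & r n = size (strokes a) /\ r n.+1 = (aeval t (nth 0 a)).+1.
Proof.
move=> Hinp.
have := @exec_load a n 0 0 (fun=> 0) (erefl _) Hinp.
rewrite size_tuple add0n => /(_ (leqnn _) (fun _ _ => erefl _)).
set r1 := (fun j => if j == n then _ else _) => H1.
have H2 := @exec_stack_code n t n.+1 r1 (nth 0 a) (leqnSn n).
rewrite /program; eexists; first apply: exec_seqD H1 (exec_seqD (H2 _ _) (exec_inc1 _ _)).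
- by move=> k le_k; rewrite /r1; do 2 (case: ifP => [|_]; first by lia).
- move=> k; rewrite /r1; case: ltnP => lt_k; last by rewrite nth_default ?size_tuple.
  by rewrite (ltn_eqF lt_k) subn0.
by rewrite /upd /r1 /= !eqxx; case: eqP => [|_]; first lia.
Qed.

End Programs.

(** * Compiling register programs to Turing machines *)

Inductive instr : Type :=
| IInc of nat
| IDec of nat
| IJz of nat & nat
| IJin of nat & nat
| IJmp of nat
| IHalt.

(* Jumps are absolute, so the code depends on its address [o]. *)
Fixpoint code_of (c : cmd) (o : nat) : seq instr :=
  match c with
  | CSkip => [::]
  | CInc r => [:: IInc r]
  | CDec r => [:: IDec r]
  | CSeq c d => let p := code_of c o in p ++ code_of d (o + size p)
  | CWhile r c => let p := code_of c o.+1 in IJz r (o + (size p).+2) :: rcons p (IJmp o)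
  | CRead r c => let p := code_of c o.+1 in IJin r (o + (size p).+2) :: rcons p (IJmp o)
  end.

Fixpoint max_reg (c : cmd) : nat :=
  match c with
  | CSkip => 0
  | CInc r | CDec r => r
  | CSeq c d => maxn (max_reg c) (max_reg d)
  | CWhile r c | CRead r c => maxn r (max_reg c)
  end.

(* The duplicates in the enumeration are harmless. *)
Lemma exists_code (T : finType) (x0 x1 : T) : x0 != x1 ->
  exists n (f : T -> 'I_n.+2) (g : 'I_n.+2 -> T),
    [/\ cancel f g, f x0 = ord0 & f x1 = @Ordinal n.+2 1 isT].
Proof.
move=> x01; pose s := [:: x0, x1 & enum T].
have size_s : size s = #|T|.+2 by rewrite /= -cardE.
exists #|T|, (fun x => inord (index x s)), (fun i => nth x0 s i).
have lt_index x : index x s < #|T|.+2.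
  by rewrite -size_s index_mem !inE mem_enum !orbT.
split=> [x||]; first by rewrite inordK // nth_index // -index_mem size_s.
  by apply: val_inj; rewrite /= inordK //= eqxx.
by apply: val_inj; rewrite /= inordK //= ?eqxx (negbTE x01) // eqxx.
Qed.

(** * The machine that executes a list of instructions on tracks *)

Section Machine.

Variables (R : nat) (O : 'I_R.+1) (code : seq instr).

(* A cell contains the mark of cell 0, the stroke of the input, and the set of
   the registers whose unary contents extend beyond it. *)
Definition tletter : Type := (bool * bool * {set 'I_R.+1})%type.

(* [inl false] is the start state and [inl true] the final one; the other
   states are the phases of the instructions of [code]. *)
Definition tstate : Type := (bool + 'I_(size code).+1 * 'I_4)%type.

Definition at_phase (pc ph : nat) : tstate := inr (inord pc, inord ph).

Definition stay : 'I_3 := inord 0.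
Definition go_right : 'I_3 := inord 1.
Definition go_left : 'I_3 := inord 2.

(** Phase 0 performs a jump or scans right to the end of a track. Phase 1 of [IDec] removes the last
    cell of the track, phase 2 returns to the mark and goes on with the next instruction, and phase
    3 of [IJin] returns and jumps. For [IHalt], phase 0 erases and phase 1 returns. *)
Definition tinstr (z : tstate) (pc ph : nat) (g : tletter) : tstate * tletter * 'I_3 :=
  let: (mk, st, rs) := g in
  match nth IHalt code pc, ph with
  | IInc r, 0 =>
    if inord r \in rs then (z, g, go_right)
    else (at_phase pc 2, (mk, st, inord r |: rs), stay)
  | IDec r, 0 =>
    if inord r \in rs then (z, g, go_right)
    else if mk then (at_phase pc.+1 0, g, stay) else (at_phase pc 1, g, go_left)
  | IDec r, 1 => (at_phase pc 2, (mk, st, rs :\ inord r), stay)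
  | IJz r a, 0 => (at_phase (if inord r \in rs then pc.+1 else a) 0, g, stay)
  | IJmp a, 0 => (at_phase a 0, g, stay)
  | IJin r a, 0 =>
    if inord r \in rs then (z, g, go_right)
    else (at_phase pc (if st then 2 else 3), g, stay)
  | IJin r a, 3 => if mk then (at_phase a 0, g, stay) else (z, g, go_left)
  | IHalt, 0 =>
    if ~~ mk && (rs == set0) then (at_phase pc 1, g, go_left)
    else (z, (mk, O \in rs, set0), go_right)
  | IHalt, _ => if mk then (inl true, (false, st, rs), stay) else (z, g, go_left)
  | _, _ => if mk then (at_phase pc.+1 0, g, stay) else (z, g, go_left)
  end.

Definition tdelta (z : tstate) (g : tletter) : tstate * tletter * 'I_3 :=
  match z with
  | inl false => (at_phase 0 0, (true, g.1.2, g.2), stay)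
  | inl true => (z, g, stay)
  | inr (pc, ph) => tinstr z pc ph g
  end.

Lemma tdelta_at pc ph g : pc <= size code -> ph < 4 ->
  tdelta (at_phase pc ph) g = tinstr (at_phase pc ph) pc ph g.
Proof. by move=> le_pc lt_ph; rewrite /= !inordK. Qed.

Variables (n1 : nat) (fz : tstate -> 'I_n1.+2) (gz : 'I_n1.+2 -> tstate).
Hypotheses (fzK : cancel fz gz) (fz0 : fz (inl false) = ord0).
Variables (n2 : nat) (fl : tletter -> 'I_n2.+2) (gl : 'I_n2.+2 -> tletter).
Hypotheses (flK : cancel fl gl) (fl0 : fl (false, false, set0) = ord0).
Hypothesis fl1 : fl (false, true, set0) = @Ordinal n2.+2 1 isT.

Definition tmachine : machine :=
  @Machine n1.+1 n2 [set fz (inl true)]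
    (fun z g => if z == fz (inl true) then (z, g, ord0) else
       let: (z', g', m) := tdelta (gz z) (gl g) in (fz z', fl g', m)).

Lemma tmachine_normed : normed tmachine.
Proof. by move=> z g; rewrite inE => /eqP-> /=; rewrite eqxx. Qed.

Variables (s : nat) (a : s.-tuple nat).

Definition conf (z : tstate) (tp : nat -> tletter) (h t : nat) : Prop :=
  exists k : config tmachine, [/\ run tmachine a t = Some k,
    cstate k = fz z, (forall i, ctape k i = fl (tp i)) & chead k = h].

Lemma conf_step z tp h t z' g m h' tp' :
  conf z tp h t -> z <> inl true -> tdelta z (tp h) = (z', g, m) ->
  move_head m h = Some h' ->
  (forall i, tp' i = if i == h then g else tp i) -> conf z' tp' h' t.+1.
Proof.
move=> [k [run_k kz kt kh]] nz dE mE tE; rewrite /conf runS run_k /= /step kt kh kz.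
rewrite /= (can_eq fzK); case: eqP => // _; rewrite fzK flK dE mE /=.
eexists; split=> //= i; rewrite tE; by case: eqP.
Qed.

Lemma scan_right z tp h t n : conf z tp h t -> z <> inl true ->
  (forall i, h <= i < h + n -> tdelta z (tp i) = (z, tp i, go_right)) ->
  conf z tp (h + n) (t + n).
Proof.
move=> C nz; elim: n => [|n IHn] H; first by rewrite !addn0.
rewrite !addnS; apply: conf_step (IHn _) nz (H _ _) _ _.
- by move=> i lt_i; apply: H; lia.
- by lia.
- by rewrite /move_head /go_right /= inordK.
- by move=> i; case: eqP => [->|].
Qed.

Lemma scan_left z tp t n : conf z tp n t -> z <> inl true ->
  (forall i, 0 < i <= n -> tdelta z (tp i) = (z, tp i, go_left)) ->
  conf z tp 0 (t + n).
Proof.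
move=> + nz; elim: n t => [|n IHn] t C H; first by rewrite addn0.
rewrite -addSnnS; apply: IHn => [|i lt_i]; last by apply: H; lia.
apply: conf_step C nz (H _ _) _ _; first by lia.
  by rewrite /move_head /go_left /= inordK.
by move=> i; case: eqP => [->|].
Qed.

Definition inp (i : nat) : bool := nth false (strokes a) i.

Definition rtape (r : nat -> nat) (i : nat) : tletter :=
  (i == 0, inp i, [set j : 'I_R.+1 | i < r j]).

Lemma eq_rtape r r' i : r =1 r' -> rtape r i = rtape r' i.
Proof. by move=> E; congr (_, _); apply/setP => j; rewrite !inE E. Qed.

Lemma eq_conf z tp tp' h t : tp =1 tp' -> conf z tp h t -> conf z tp' h t.
Proof. by move=> E [k [H1 H2 H3 H4]]; exists k; split=> // i; rewrite H3 E. Qed.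

Lemma mem_rtape (k : nat) (r : nat -> nat) i : k <= R ->
  ((inord k : 'I_R.+1) \in [set j : 'I_R.+1 | i < r j]) = (i < r k).
Proof. by move=> le_k; rewrite inE inordK. Qed.

Lemma conf_init : conf (inl false) (fun i => (false, inp i, set0)) 0 0.
Proof.
exists (init tmachine a); split=> //= i.
rewrite /tape_of /input_word /inp.
elim: (tval a) i => [|x b IHb] i; first by rewrite !nth_nil fl0.
rewrite [strokes _](_ : _ = nseq x.+1 true ++ false :: strokes b) //.
rewrite [flatten _](_ : _ = nseq x.+1 (stroke tmachine) ++
  blank tmachine :: flatten [seq rcons (unary tmachine x) (blank tmachine) | x <- b]);
  last by rewrite map_cons -cat1s flatten_cat [flatten [:: _]]cats0 cat_rcons.
rewrite !nth_cat !size_nseq; case: ltnP => [lt_i|le_i].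
  by rewrite !nth_nseq lt_i fl1; apply: val_inj.
by case: (i - x.+1) => [|j]; rewrite /= ?fl0 // IHb.
Qed.

Lemma conf_start : conf (at_phase 0 0) (rtape (fun=> 0)) 0 1.
Proof.
apply: conf_step conf_init _ _ _ _; first by [].
- by rewrite /=.
- by rewrite /move_head /stay /= inordK.
move=> i; rewrite /rtape; have -> : [set j : 'I_R.+1 | i < 0] = set0.
  by apply/setP => j; rewrite !inE ltn0.
by case: eqP => [->|].
Qed.

Lemma move_stay h : move_head stay h = Some h.
Proof. by rewrite /move_head /stay /= inordK. Qed.

Lemma conf_return pc ph b r n t : pc <= size code -> ph < 4 ->
  (forall i, tinstr (at_phase pc ph) pc ph (rtape r i) =
    if i == 0 then (at_phase b 0, rtape r i, stay)
    else (at_phase pc ph, rtape r i, go_left)) ->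
  conf (at_phase pc ph) (rtape r) n t ->
  conf (at_phase b 0) (rtape r) 0 (t + n).+1.
Proof.
move=> le_pc lt_ph H C.
have C0 : conf (at_phase pc ph) (rtape r) 0 (t + n).
  apply: scan_left C _ _ => // i lt_i.
  by rewrite tdelta_at // H; case: eqP => //; lia.
apply: conf_step C0 _ _ (move_stay _) _ => //; first by rewrite tdelta_at // H.
by move=> i; case: eqP => [->|].
Qed.

Section Instructions.

Variables (pc : nat) (r : nat -> nat) (k : nat).
Hypotheses (lt_pc : pc < size code) (le_k : k <= R).

Lemma scan_register t :
  (forall g : tletter, inord k \in g.2 ->
     tinstr (at_phase pc 0) pc 0 g = (at_phase pc 0, g, go_right)) ->
  conf (at_phase pc 0) (rtape r) 0 t ->
  conf (at_phase pc 0) (rtape r) (r k) (t + r k).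
Proof.
move=> H C; apply: (scan_right (n := r k)) C _ _ => // i lt_i.
rewrite tdelta_at // ?H ?(ltnW lt_pc) //= mem_rtape //; lia.
Qed.

Lemma conf_inc t : nth IHalt code pc = IInc k ->
  conf (at_phase pc 0) (rtape r) 0 t ->
  conf (at_phase pc.+1 0) (rtape (upd r k (r k).+1)) 0 (t + r k + 1 + r k).+1.
Proof.
move=> def_i C.
have {}C : conf (at_phase pc 0) (rtape r) (r k) (t + r k).
  by apply: scan_register C => -[[mk st] rs] /= k_rs; rewrite /tinstr def_i k_rs.
apply: (conf_return (pc := pc) (ph := 2)) => //; first exact: ltnW.
  by move=> i; rewrite /tinstr /rtape def_i.
rewrite addn1; apply: conf_step C _ _ (move_stay _) _ => //.
  rewrite tdelta_at // ?(ltnW lt_pc) // /tinstr def_i /= mem_rtape // ltnn.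
  by [].
move=> i; case: eqP => [->|ne_i]; congr (_, _); apply/setP => j; rewrite !inE /upd.
  by rewrite -val_eqE /= inordK //; case: eqP => [->|_] //=; rewrite ltnSn.
by case: eqP => [j_k|//]; rewrite j_k ltnS leq_eqVlt; case: eqP.
Qed.

Lemma conf_dec t : nth IHalt code pc = IDec k ->
  conf (at_phase pc 0) (rtape r) 0 t ->
  exists2 t', t' <= t + (2 * r k + 5)
    & conf (at_phase pc.+1 0) (rtape (upd r k (r k).-1)) 0 t'.
Proof.
move=> def_i C.
have {}C : conf (at_phase pc 0) (rtape r) (r k) (t + r k).
  by apply: scan_register C => -[[mk st] rs] /= k_rs; rewrite /tinstr def_i k_rs.
case def_m: (r k) C => [|m] C.
  exists (t + 0).+1; first by lia.
  apply: conf_step C _ _ (move_stay _) _ => //.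
    by rewrite tdelta_at // ?(ltnW lt_pc) // /tinstr def_i /= mem_rtape // def_m.
  move=> i; rewrite (_ : rtape _ i = rtape r i); first by case: eqP => [->|].
  by apply: eq_rtape => j; rewrite /upd; case: eqP => // ->.
have C1 : conf (at_phase pc 1) (rtape r) m (t + m.+1).+1.
  apply: conf_step C _ _ _ _ => //.
  - by rewrite tdelta_at // ?(ltnW lt_pc) // /tinstr def_i /= mem_rtape // def_m ltnn.
  - by rewrite /move_head /go_left /= inordK.
  by move=> i; case: eqP => [->|].
exists ((t + m.+1).+2 + m).+1; first by lia.
apply: (conf_return (pc := pc) (ph := 2)) => //; first exact: ltnW.
  by move=> i; rewrite /tinstr /rtape def_i.
apply: conf_step C1 _ _ (move_stay _) _ => //.
  by rewrite tdelta_at // ?(ltnW lt_pc) // /tinstr def_i.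
move=> i; case: eqP => [->|ne_i]; congr (_, _); apply/setP => j; rewrite !inE /upd.
  by rewrite -val_eqE /= inordK //; case: eqP => [->|_] //=; rewrite ltnn.
by case: eqP => [j_k|//]; rewrite j_k def_m /= ltnS [in RHS]leq_eqVlt; case: eqP.
Qed.

Lemma conf_jz b t : nth IHalt code pc = IJz k b ->
  conf (at_phase pc 0) (rtape r) 0 t ->
  conf (at_phase (if r k == 0 then b else pc.+1) 0) (rtape r) 0 t.+1.
Proof.
move=> def_i C; apply: conf_step C _ _ (move_stay _) _ => //.
  rewrite tdelta_at // ?(ltnW lt_pc) // /tinstr def_i /= mem_rtape //.
  by rewrite lt0n; case: eqP.
by move=> i; case: eqP => [->|].
Qed.

Lemma conf_jmp b t : nth IHalt code pc = IJmp b ->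
  conf (at_phase pc 0) (rtape r) 0 t -> conf (at_phase b 0) (rtape r) 0 t.+1.
Proof.
move=> def_i C; apply: conf_step C _ _ (move_stay _) _ => //.
  by rewrite tdelta_at // ?(ltnW lt_pc) // /tinstr def_i.
by move=> i; case: eqP => [->|].
Qed.

Lemma conf_jin b t : nth IHalt code pc = IJin k b ->
  conf (at_phase pc 0) (rtape r) 0 t ->
  conf (at_phase (if inp (r k) then pc.+1 else b) 0) (rtape r) 0 (t + r k + 1 + r k).+1.
Proof.
move=> def_i C.
have {}C : conf (at_phase pc 0) (rtape r) (r k) (t + r k).
  by apply: scan_register C => -[[mk st] rs] /= k_rs; rewrite /tinstr def_i k_rs.
apply: (conf_return (pc := pc) (ph := if inp (r k) then 2 else 3)).
- exact: ltnW.
- by case: ifP.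
- by move=> i; rewrite /tinstr /rtape def_i; case: ifP.
rewrite addn1; apply: conf_step C _ _ (move_stay _) _ => //.
  by rewrite tdelta_at // ?(ltnW lt_pc) // /tinstr def_i /= mem_rtape // ltnn.
by move=> i; case: eqP => [->|].
Qed.

End Instructions.

Definition located (c : cmd) (o : nat) : Prop :=
  o + size (code_of c o) <= size code /\
  forall j, j < size (code_of c o) -> nth IHalt code (o + j) = nth IHalt (code_of c o) j.

Lemma located_seq c d o : located (CSeq c d) o ->
  located c o /\ located d (o + size (code_of c o)).
Proof.
rewrite /located /= size_cat => -[le_o H]; split; split; try lia.
  by move=> j lt_j; rewrite H ?nth_cat ?lt_j //; lia.
move=> j lt_j; rewrite -addnA H; last by lia.
by rewrite nth_cat ltnNge leq_addr addKn.
Qed.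

Lemma located_loop c o (p := code_of c o.+1) x :
  o + (size p).+2 <= size code ->
  (forall j, j < (size p).+2 ->
     nth IHalt code (o + j) = nth IHalt (x :: rcons p (IJmp o)) j) ->
  [/\ nth IHalt code o = x, located c o.+1 & nth IHalt code (o.+1 + size p) = IJmp o].
Proof.
move=> le_o H; split.
- by rewrite -[o]addn0 H.
- split=> [|j lt_j]; first by rewrite -/p; lia.
  have /= := H j.+1; rewrite addnS -addSn nth_rcons -/p lt_j => -> //.
  exact: leqW.
- by rewrite addSnnS H //= nth_rcons ltnn eqxx.
Qed.

Definition bounded (r : nat -> nat) (V : nat) : Prop := forall k, k <= R -> r k <= V.

(** Registers grow by at most 1 per elementary instruction, hence stay below [V + n]; each
    instruction crosses a track at most once in each direction, in at most [2 * (V + n) + 5]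
    steps. *)
Lemma exec_conf c r r' n : exec inp c r r' n ->
  forall o V t, located c o -> max_reg c <= R -> bounded r V ->
  conf (at_phase o 0) (rtape r) 0 t ->
  bounded r' (V + n) /\
  exists2 t', t' <= t + n * (2 * (V + n) + 5)
    & conf (at_phase (o + size (code_of c o)) 0) (rtape r') 0 t'.
Proof.
elim=> {c r r' n}.
- move=> r r' n E o V t _ _ rV C; split.
    by move=> k /rV; rewrite E; lia.
  exists t; first by lia.
  by rewrite addn0; apply: eq_conf C => i; apply: eq_rtape.
- move=> k r r' n n_gt0 E o V t [lt_o Ho] /= le_k rV C; split.
    by move=> j /rV le_j; rewrite E /upd; case: eqP => [<-|_]; lia.
  have lt_o' : o < size code by rewrite /= addn1 in lt_o.
  exists (t + r k + 1 + r k).+1; first by have := rV k le_k; nia.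
  rewrite addn1; apply: eq_conf (conf_inc lt_o' le_k _ C) => [i|].
    exact: eq_rtape.
  by rewrite -[o]addn0 Ho.
- move=> k r r' n n_gt0 E o V t [lt_o Ho] /= le_k rV C; split.
    by move=> j /rV le_j; rewrite E /upd; case: eqP => [<-|_]; lia.
  have lt_o' : o < size code by rewrite /= addn1 in lt_o.
  have [|t' le_t' C'] := conf_dec lt_o' le_k _ C; first by rewrite -[o]addn0 Ho.
  exists t'; first by have := rV k le_k; nia.
  by rewrite addn1; apply: eq_conf C' => i; apply: eq_rtape.
- move=> c d r1 r2 r3 n1' n2' n _ IH1 _ IH2 le_n o V t /located_seq[Lc Ld] /=.
  rewrite geq_max => /andP[Rc Rd] rV C.
  have [rV2 [t2 le_t2 C2]] := IH1 _ _ _ Lc Rc rV C.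
  have [rV3 [t3 le_t3 C3]] := IH2 _ _ _ Ld Rd rV2 C2.
  split; first by move=> k /rV3; lia.
  by exists t3; [nia | rewrite size_cat addnA].
- move=> k c r r' n n_gt0 rk E o V t [lt_o Ho] /=; rewrite geq_max => /andP[le_k Rc] rV C.
  split; first by move=> j /rV; rewrite E; lia.
  move: lt_o Ho; rewrite /= size_rcons => lt_o Ho.
  have [def_o _ _] := located_loop lt_o Ho.
  have lt_o' : o < size code by lia.
  exists t.+1; first by nia.
  have := conf_jz lt_o' le_k def_o C; rewrite rk eqxx => C'.
  by apply: eq_conf C' => i; apply: eq_rtape.
- move=> k c r1 r2 r3 n1' n2' n rk _ IH1 _ IH2 le_n o V t L.
  have [lt_o Ho] := L; move: lt_o Ho => /=; rewrite geq_max size_rcons => lt_o Ho.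
  case/andP=> le_k Rc rV C; have [def_o Lc def_j] := located_loop lt_o Ho.
  have lt_o' : o < size code by lia.
  have := conf_jz lt_o' le_k def_o C; rewrite (negbTE rk) => C1.
  have [rV2 [t2 le_t2 C2]] := IH1 _ _ _ Lc Rc rV C1.
  have lt_j : o.+1 + size (code_of c o.+1) < size code by lia.
  have C3 := conf_jmp lt_j def_j C2.
  have [|rV4 [t4 le_t4 C4]] := IH2 _ _ _ L _ rV2 C3.
    by rewrite /= geq_max le_k.
  split; first by move=> j /rV4; lia.
  by exists t4; [nia | move: C4; rewrite /= size_rcons].
- move=> k c r r' n n_gt0 rk E o V t [lt_o Ho] /=; rewrite geq_max => /andP[le_k Rc] rV C.
  split; first by move=> j /rV; rewrite E; lia.
  move: lt_o Ho; rewrite /= size_rcons => lt_o Ho.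
  have [def_o _ _] := located_loop lt_o Ho.
  have lt_o' : o < size code by lia.
  exists (t + r k + 1 + r k).+1; first by have := rV _ le_k; nia.
  have := conf_jin lt_o' le_k def_o C; rewrite (negbTE rk) => C'.
  by apply: eq_conf C' => i; apply: eq_rtape.
- move=> k c r1 r2 r3 n1' n2' n rk _ IH1 _ IH2 le_n o V t L.
  have [lt_o Ho] := L; move: lt_o Ho => /=; rewrite geq_max size_rcons => lt_o Ho.
  case/andP=> le_k Rc rV C; have [def_o Lc def_j] := located_loop lt_o Ho.
  have lt_o' : o < size code by lia.
  have := conf_jin lt_o' le_k def_o C; rewrite rk => C1.
  have [rV2 [t2 le_t2 C2]] := IH1 _ _ _ Lc Rc rV C1.
  have lt_j : o.+1 + size (code_of c o.+1) < size code by lia.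
  have C3 := conf_jmp lt_j def_j C2.
  have [|rV4 [t4 le_t4 C4]] := IH2 _ _ _ L _ rV2 C3.
    by rewrite /= geq_max le_k.
  split; first by move=> j /rV4; lia.
  exists t4; first by have := rV _ le_k; nia.
  by move: C4; rewrite /= size_rcons.
Qed.

(* Erases the tracks from left to right, keeping the output, and comes back. *)
Lemma conf_sweep (r : nat -> nat) e t :
  0 < e -> r O <= e -> 0 < r O ->
  (forall i, i < e -> exists k : 'I_R.+1, i < r k) ->
  (forall k : 'I_R.+1, r k <= e) -> (forall i, e <= i -> ~~ inp i) ->
  conf (at_phase (size code) 0) (rtape r) 0 t ->
  conf (inl true) (fun i => (false, i < r O, set0)) 0 (t + 2 * e + 1).
Proof.
move=> e_gt0 le_O O_gt0 r_e le_e inp_e C.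
have haltE : nth IHalt code (size code) = IHalt by rewrite nth_default.
pose sw m i : tletter := if i < m then (i == 0, i < r O, set0) else rtape r i.
have swept m : m <= e -> conf (at_phase (size code) 0) (sw m) m (t + m).
  elim: m => [|m IHm] le_m; first by rewrite addn0; apply: eq_conf C.
  rewrite addnS; apply: conf_step (IHm (ltnW le_m)) _ _ _ _ => //.
  - rewrite tdelta_at // /sw ltnn /tinstr haltE /rtape.
    have [k lt_k] := r_e m le_m.
    have /negbTE-> : [set j : 'I_R.+1 | m < r j] != set0.
      by apply/set0Pn; exists k; rewrite inE.
    by rewrite andbF.
  - by rewrite /move_head /go_right /= inordK.
  - move=> i; rewrite /sw ltnS leq_eqVlt; case: eqP => //= ->.
    by rewrite inE.
have rtape_e i : e <= i -> rtape r i = (false, false, set0).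
  move=> le_i; rewrite /rtape (negbTE (inp_e i le_i)).
  have -> : (i == 0) = false by lia.
  congr (_, _); apply/setP => k; rewrite !inE; apply/negbTE; rewrite -leqNgt.
  exact: leq_trans (le_e k) le_i.
have C1 : conf (at_phase (size code) 1) (sw e) e.-1 (t + e).+1.
  apply: conf_step (swept e (leqnn e)) _ _ _ _ => //.
  - by rewrite tdelta_at // /sw ltnn rtape_e // /tinstr haltE /= eqxx.
  - by rewrite /move_head /go_left /= inordK //; case: (e) e_gt0.
  - by move=> i; case: eqP => [->|//]; rewrite /sw ltnn rtape_e.
have C2 : conf (at_phase (size code) 1) (sw e) 0 ((t + e).+1 + e.-1).
  apply: scan_left C1 _ _ => // i lt_i; rewrite tdelta_at // /sw.
  have -> : i < e by lia.
  by rewrite /tinstr haltE; case: eqP => //; lia.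
have -> : t + 2 * e + 1 = ((t + e).+1 + e.-1).+1 by lia.
apply: conf_step C2 _ _ (move_stay _) _ => //.
  by rewrite tdelta_at // /sw e_gt0 /tinstr haltE.
move=> i; case: eqP => [->//|ne_i]; rewrite /sw; case: (ltnP i e) => [_|le_i].
  by rewrite (introF eqP ne_i).
by rewrite rtape_e // ltnNge (leq_trans le_O).
Qed.

End Machine.

Lemma halts_before M s (a : s.-tuple nat) t k :
  run M a t = Some k -> cstate k \in final M ->
  exists t0 (k0 : config M), t0 <= t /\ halts_at a t0 k0.
Proof.
move=> run_t fin_k.
pose fin_at u := if run M a u is Some k then cstate k \in final M else false.
have ex_fin : exists u, fin_at u by exists t; rewrite /fin_at run_t.
case: (ex_minnP ex_fin) => t0 fin_t0 min_t0; move: (fin_t0).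
rewrite {1}/fin_at; case run_t0: (run M a t0) => [k0|//] fin_k0.
exists t0, k0; split; first by apply: min_t0; rewrite /fin_at run_t.
split=> // u k' lt_u run_u; apply/negP => fin_k'.
by have := min_t0 u; rewrite /fin_at run_u => /(_ fin_k'); rewrite leqNgt lt_u.
Qed.

Lemma load_cost_aterm s : exists u, forall a : s.-tuple nat, aeval u (nth 0 a) = load_cost a.
Proof.
have H m : exists u, forall e, aeval u e = load_cost [seq e k | k <- iota m s].
  elim: (s) m => [|s' IHs] m; first by exists (ACst 0).
  have [u Hu] := IHs m.+1.
  by exists (AAdd (AAdd (AMul (ACst 4) (AVar m)) (ACst 7)) u) => e /=; rewrite Hu.
have [u Hu] := H 0; exists u => a; rewrite Hu; congr load_cost.
by rewrite -[in RHS](mkseq_nth 0 a) size_tuple.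
Qed.

Theorem aterm_machine s (t : aterm) : exists (M : machine) (T : s.-tuple nat -> nat),
  [/\ computes M (fun a : s.-tuple nat => aeval t (nth 0 a)), elementary T & time_bounded M T].
Proof.
pose c := program s t; pose code := code_of c 0.
pose R := maxn (max_reg c) s.+1.
have le_cR : max_reg c <= R := leq_maxl _ _.
have lt_sR : s.+1 < R.+1 by rewrite ltnS leq_maxr.
pose O : 'I_R.+1 := Ordinal lt_sR.
have [n1 [fz [gz [fzK fz0 _]]]] := @exists_code (tstate code) (inl false) (inl true) isT.
have [n2 [fl [gl [flK fl0 fl1]]]] :=
  @exists_code (tletter R) (false, false, set0) (false, true, set0) isT.
pose M := tmachine O fz gz fl gl.
have [w Hw] := load_cost_aterm s.
pose n (a : s.-tuple nat) := aeval (AAdd w (AAdd (stack_cost t) (ACst 1))) (nth 0 a).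
(* One step marks cell 0, the product bounds the program started with null registers, and
   [2 * n a + 1] bounds the final sweep, whose extent is the largest register. *)
pose T a := 1 + n a * (2 * n a + 5) + 2 * n a + 1.
have Tn : elementary n by apply: elementary_aeval.
have halting a : exists t0 (k0 : config M), [/\ t0 <= T a, halts_at a t0 k0
    & is_output k0 (aeval t (nth 0 a))].
  have [r Hexec [r_s r_O]] := exec_program t (a := a) (fun i => erefl (inp a i)).
  have C0 := conf_start O fzK fz0 flK fl0 fl1 a.
  have L : located code c 0 by split.
  have [|rV [t1 le_t1 C1]] := exec_conf fzK flK Hexec L le_cR _ C0 (V := 0).
    by [].
  rewrite add0n in rV C1; rewrite add0n in le_t1.
  have nE : n a = load_cost a + (aeval (stack_cost t) (nth 0 a) + 1) by rewrite /n /= Hw.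
  rewrite -nE in rV le_t1.
  pose e := \max_(k < R.+1) r k.
  have le_e (k : 'I_R.+1) : r k <= e by apply: leq_bigmax.
  have e_n : e <= n a by apply/bigmax_leqP => k _; apply: rV; rewrite -ltnS.
  have O_gt0 : 0 < r O by rewrite r_O.
  have e_gt0 : 0 < e := leq_trans O_gt0 (le_e O).
  have C2 := conf_sweep fzK flK e_gt0 (le_e O) O_gt0 _ le_e _ C1.
  have [||k [run_k kz kt kh]] := C2.
  - move=> i lt_i; apply/existsP; apply: contraLR lt_i => /existsPn H.
    by rewrite -leqNgt; apply/bigmax_leqP => k _; rewrite leqNgt.
  - move=> i le_i; rewrite /inp nth_default // -r_s.
    have lt_s : s < R.+1 by apply: ltnW.
    exact: leq_trans (le_e (Ordinal lt_s)) le_i.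
  have fin_k : cstate k \in final M by rewrite inE kz.
  have [t0 [k0 [le_t0 halt0]]] := halts_before run_k fin_k.
  exists t0, k0; split=> //; first by rewrite /T; lia.
  (* The output is known at the end of the sweep; the machine being normed, it is already there at
     the first final configuration [k0]. *)
  have [k' [run_k' hk' tk']] := run_halted (@tmachine_normed _ _ _ _ _ _ _ _ _) halt0 le_t0.
  move: run_k'; rewrite run_k => -[E]; rewrite -E in hk' tk'.
  split=> [|i]; first by rewrite -hk' kh.
  rewrite -tk' kt /tape_of /unary nth_nseq r_O.
  by case: ifP; rewrite ?fl1 ?fl0.
exists M, T; split.
- by move=> a; have [t0 [k0 [_ ? ?]]] := halting a; exists t0, k0.
- by apply: elementary_add (elementary_const _ _); apply: elementary_add;
    [apply: elementary_add (elementary_const _ _) _; apply: elementary_mul => //;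
     apply: elementary_add (elementary_const _ _); apply: elementary_mul (elementary_const _ _) _
    | apply: elementary_mul (elementary_const _ _) _].
- by move=> a; have [t0 [k0 [le_t0 ? _]]] := halting a; exists t0 => //; exists k0.
Qed.

(** * Equivalence of the two classes *)

Section Normalization.

Variable M : machine.

(** The universal term requires a normed machine. Since halting looks only at the first visit to a
    final state, changing [delta] on final states affects neither the result nor the time. *)
Definition normalize : machine :=
  @Machine (nz M) (ng M) (final M)
    (fun z g => if z \in final M then (z, g, ord0) else delta z g).

Definition to_normalize (k : config M) : config normalize :=
  @Config normalize (cstate k) (ctape k) (chead k).

Lemma normalize_normed : normed normalize.
Proof. by move=> z g /= ->. Qed.

Lemma run_normalize s (a : s.-tuple nat) t :
  (forall u k, u < t -> run M a u = Some k -> cstate k \notin final M) ->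
  run normalize a t = omap to_normalize (run M a t).
Proof.
elim: t => [//|t IHt] Hfin; rewrite !runS IHt => [|u k lt_u]; last by apply: Hfin; lia.
case run_t: (run M a t) => [k|//] /=.
rewrite /step /= (negbTE (Hfin t k (ltnSn t) run_t)).
by case: (delta _ _) => [[z g] m]; case: (move_head _ _).
Qed.

Lemma halts_at_normalize s (a : s.-tuple nat) t k :
  halts_at (M := M) a t k -> halts_at a t (to_normalize k).
Proof.
move=> [run_t fin_k first_k]; split=> //.
  by rewrite run_normalize ?run_t // => u k' lt_u; apply: first_k.
move=> u k' lt_u; rewrite run_normalize => [|v k'' lt_v]; last first.
  by apply: first_k; apply: ltn_trans lt_u.
case run_u: (run M a u) => [k1|//] [<-].
exact: first_k lt_u run_u.
Qed.

Lemma computes_normalize s (f : s.-tuple nat -> nat) :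
  computes M f -> computes normalize f.
Proof.
move=> compM a; have [t [k [halt_k out_k]]] := compM a.
by exists t, (to_normalize k); split; [apply: halts_at_normalize | ].
Qed.

End Normalization.

Lemma exists_program_code M : exists C, program_code M C.
Proof.
(* [c] exceeds every state, letter and move number, so that their powers of 2 are below [2 ^ c]. *)
pose c := nz M + ng M + 5; pose l := enum {: state M * letter M}.
exists (cantor c (of_digits (2 ^ c) (flatten [seq instruction_digits zg | zg <- l]))).
exists c, l; split=> //; apply/allP => d /flatten_mapP[[z g] _].
rewrite /instruction_digits; case: (delta _ _) => [[z' g'] m] /= d_in.
have := ltn_ord z; have := ltn_ord g; have := ltn_ord z'; have := ltn_ord g'.
have := ltn_ord m => *.
suff lt_exp x : x < c -> 2 ^ x < 2 ^ c.
  by move: d_in; rewrite !inE => /or4P[|||/orP[]] /eqP->; apply: lt_exp; rewrite /c; lia.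
by move=> lt_x; rewrite ltn_exp2l.
Qed.

Theorem theorem3 (s : nat) :
  (exists Upsilon : term s.+2,
     forall (f : s.-tuple nat -> nat) (M : machine) (C : nat),
       normed M -> computes M f -> program_code M C ->
       forall (a : s.-tuple nat) (t T : nat),
         comp_time M a t -> t <= T ->
         eval Upsilon [tuple of C :: rcons a T] = f a)
  /\
  (forall f : s.-tuple nat -> nat,
     elementary f <->
     exists (M : machine) (T : s.-tuple nat -> nat),
       [/\ computes M f, elementary T & time_bounded M T]).
Proof.
have [u Hu] := universal_aterm s; split.
  exists (term_of s.+2 u) => f M C normM compM codeM a t T time_t le_tT.
  by rewrite eval_term_of; apply: Hu time_t le_tT.
move=> f; split=> [/elementary_aterm[t Ht]|[M [T [compM elemT boundT]]]].
  have [M [T [compM elemT boundT]]] := aterm_machine s t.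
  by exists M, T; split=> // a; rewrite -Ht.
have [C codeC] := exists_program_code (normalize M).
have [tT HT] := elementary_aterm elemT.
(* The machine being fixed, its code is a constant; the time bound is replaced by its term [tT], and
   the universal term becomes a term in the arguments alone. *)
pose sub k := if k is k'.+1 then 
  if k' < s then AVar k' else if k' == s then tT else ACst 0 else ACst C.
apply: elem_ext (elementary_aeval s (asubst sub u)) => a.
have [t [k halt_k] le_t] := boundT a.
rewrite aeval_subst -(Hu f _ C (@normalize_normed M) (computes_normalize compM)
  codeC a t (T a) _ le_t); last by exists (to_normalize k); apply: halts_at_normalize.
apply: eq_aeval => -[|j] //=; rewrite nth_rcons size_tuple.
by case: ifP => // _; case: ifP => // _; rewrite HT.
Qed.
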